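(* Let $\Lambda$ be an artin algebra, $n\ge 1$ an integer, $\mathcal M$ an $n$-cluster tilting subcategory of $\mathrm{mod}\text{-}\Lambda$ and $F$ an additive subfunctor of $\mathrm{Ext}^n_{\mathcal M}(-,-)$. The contravariant functor $\Phi'_F:\mathcal E_F(\mathcal M)\to\mathcal M\text{-}\mathrm{mod}_F$ is full, dense and objective. In particular, it induces a duality $\widetilde{\Phi'}_F:\widetilde{\mathcal E_F}(\mathcal M)\to\mathcal M\text{-}\mathrm{mod}_F$ such that $\widetilde{\Phi'}_F\circ\pi=\Phi'_F$, where $\pi:\mathcal E_F(\mathcal M)\to\widetilde{\mathcal E_F}(\mathcal M)$ is the canonical quotient functor.
   Context: $\Lambda$ is an artin algebra, $\mathrm{mod}\text{-}\Lambda$ the category of finitely generated right $\Lambda$-modules. An $n$-cluster tilting subcategory $\mathcal M$ of $\mathrm{mod}\text{-}\Lambda$ is a full additive, functorially finite, generating and cogenerating subcategory with $\mathcal M=\{X\mid \mathrm{Ext}^i_\Lambda(\mathcal M,X)=0,\ 0<i<n\}=\{X\mid \mathrm{Ext}^i_\Lambda(X,\mathcal M)=0,\ 0<i<n\}$. Write $\mathcal M(X,Y)=\mathrm{Hom}_\Lambda(X,Y)$. An $n$-exact sequence in $\mathcal M$ is a sequence $0\to M^0\to M^1\to\cdots\to M^n\to M^{n+1}\to 0$ in $\mathcal M$ such that for all $X\in\mathcal M$ the sequences $0\to\mathcal M(X,M^0)\to\cdots\to\mathcal M(X,M^{n+1})$ and $0\to\mathcal M(M^{n+1},X)\to\cdots\to\mathcal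 M(M^0,X)$ are exact. $\mathrm{Ext}^n_{\mathcal M}(N,L)$ is the abelian group (under Baer sum) of Yoneda equivalence classes of $n$-exact sequences from $L$ to $N$ (equivalence generated by morphisms of $n$-exact sequences that are identities on $L$ and $N$); it is an additive bifunctor via $n$-pullback and $n$-pushout. An additive subfunctor $F$ is an additive sub-bifunctor; it corresponds to a collection of $n$-exact sequences, called $F$-exact, closed under isomorphisms, direct sums, $n$-pullbacks and $n$-pushouts. $\mathcal E_F(\mathcal M)$ is the category whose objects are the $F$-exact sequences and whose morphisms are morphisms of complexes. $\widetilde{\mathcal E_F}(\mathcal M)$ is its homotopy category, i.e. the quotient of $\mathcal E_F(\mathcal M)$ by the ideal of null-homotopic morphisms. $\mathcal M\text{-}\mathrm{mod}$ is the category of finitely presented covariant additive functors $\mathcal M\to\mathcal Ab$. $\mathcal M\text{-}\mathrm{mod}_F$ is its full subcategory of functors $G$ for which there is an $F$-exact sequence $0\to M^0\to M^1\to\cdots\to M^{n+1}\to 0$ with $G\simeq\mathrm{Coker}(\mathcal M(M^1,-)\to\mathcal M(M^0,-))$. The contravariant functor $\Phi'_F$ is the composition $\mathcal E_F(\mathcal M)\xrightarrow{\sigma'_F}\mathcal F_F(\mathcal M)\xrightarrow{\Psi'_F}\mathcal M\text{-}\mathrm{mod}_F$. Here $\mathcal F_F(\mathcal M)$ is the full subcategory of the morphism category of $\mathcal M$ (objects: morphisms of $\mathcal M$; morphisms: commutative squares) consisting of $F$-epimorphisms, i.e. morphisms occurring as the last map $M^n\to M^{n+1}$ of an $F$-exact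 sequence; $\sigma'_F$ sends an $F$-exact sequence to its last map $M^n\to M^{n+1}$; and the contravariant functor $\Psi'_F$ sends an $F$-epimorphism $f:M^n\to M^{n+1}$ to $\mathrm{Coker}(\mathcal M(M^1,-)\to\mathcal M(M^0,-))$, where $0\to M^0\to M^1\to\cdots\to M^n\xrightarrow{f}M^{n+1}\to0$ is obtained by taking an $n$-kernel of $f$, and a commutative square to the map induced on these cokernels by any extension of the square to a morphism of $n$-exact sequences (this is well defined and independent of choices up to isomorphism). An additive (co- or contravariant) functor $H:\mathcal X\to\mathcal Y$ between additive categories is objective if every morphism $f$ in $\mathcal X$ with $H(f)=0$ factors through an object $K$ with $H(K)=0$. *)

(* Defs.v *)
From HB Require Import structures.
From mathcomp Require Import all_boot all_algebra.
From mathcomp Require Import boolp.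
From Stdlib Require Import Relation_Operators.

Set Implicit Arguments.
Unset Strict Implicit.
Unset Printing Implicit Defensive.

Import GRing.Theory.
Import Quotient.
Local Open Scope ring_scope.

(** * Preadditive categories and functors

    The hom-groups are given by explicit group operations rather than by a
    [zmodType]: natural transformations between functors defined on a large
    category of modules live in a universe above the one of [zmodType]. *)

Record preaddCat := PreaddCat {
  pob :> Type;
  phom : pob -> pob -> Type;
  pid : forall X, phom X X;
  pcomp : forall X Y Z, phom Y Z -> phom X Y -> phom X Z;
  pzero : forall X Y, phom X Y;
  padd : forall X Y, phom X Y -> phom X Y -> phom X Y;
  popp : forall X Y, phom X Y -> phom X Y;
  pcompA : forall X Y Z W (h : phom Z W) (g : phom Y Z) (f : phom X Y),
    pcomp h (pcomp g f) = pcomp (pcomp h g) f;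
  pcomp1f : forall X Y (f : phom X Y), pcomp (pid Y) f = f;
  pcompf1 : forall X Y (f : phom X Y), pcomp f (pid X) = f;
  paddA : forall X Y (f g h : phom X Y), padd f (padd g h) = padd (padd f g) h;
  paddC : forall X Y (f g : phom X Y), padd f g = padd g f;
  padd0f : forall X Y (f : phom X Y), padd (pzero X Y) f = f;
  paddNf : forall X Y (f : phom X Y), padd (popp f) f = pzero X Y;
  pcompDl : forall X Y Z (g h : phom Y Z) (f : phom X Y),
    pcomp (padd g h) f = padd (pcomp g f) (pcomp h f);
  pcompDr : forall X Y Z (g : phom Y Z) (f h : phom X Y),
    pcomp g (padd f h) = padd (pcomp g f) (pcomp g h)
}.
Arguments phom {C} X Y : rename.
Arguments pid {C} X : rename.
Arguments pzero {C} X Y : rename.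

Notation "g ∙ f" := (pcomp g f) (at level 40, left associativity).

Section PreaddTheory.
Variable C : preaddCat.
Implicit Types X Y Z : C.

Lemma paddf0 X Y (f : phom X Y) : padd f (pzero X Y) = f.
Proof. by rewrite paddC padd0f. Qed.

Lemma paddfN X Y (f : phom X Y) : padd f (popp f) = pzero X Y.
Proof. by rewrite paddC paddNf. Qed.

Lemma paddI X Y (f g h : phom X Y) : padd f g = padd f h -> g = h.
Proof.
by move=> e; rewrite -[g]padd0f -[h]padd0f -(paddNf f) -!paddA e.
Qed.

Lemma popp_uniq X Y (f g : phom X Y) : padd f g = pzero X Y -> g = popp f.
Proof. by move=> e; apply: (paddI (f := f)); rewrite e paddfN. Qed.

Lemma pcompf0 X Y Z (g : phom Y Z) : g ∙ pzero X Y = pzero X Z.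
Proof. by apply: (paddI (f := g ∙ pzero X Y)); rewrite -pcompDr !paddf0. Qed.

Lemma pcomp0f X Y Z (f : phom X Y) : pzero Y Z ∙ f = pzero X Z.
Proof. by apply: (paddI (f := pzero Y Z ∙ f)); rewrite -pcompDl !paddf0. Qed.

Lemma pcompNf X Y Z (g : phom Y Z) (f : phom X Y) :
  popp g ∙ f = popp (g ∙ f).
Proof. by apply: popp_uniq; rewrite -pcompDl paddfN pcomp0f. Qed.

Lemma pcompfN X Y Z (g : phom Y Z) (f : phom X Y) :
  g ∙ popp f = popp (g ∙ f).
Proof. by apply: popp_uniq; rewrite -pcompDr paddfN pcompf0. Qed.

Lemma paddACA X Y (a b c d : phom X Y) :
  padd (padd a b) (padd c d) = padd (padd a c) (padd b d).
Proof. by rewrite -!paddA; congr padd; rewrite !paddA [padd b c]paddC. Qed.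

Lemma poppD X Y (f g : phom X Y) : popp (padd f g) = padd (popp f) (popp g).
Proof. by apply/esym/popp_uniq; rewrite paddACA !paddfN paddf0. Qed.

Lemma poppK X Y (f : phom X Y) : popp (popp f) = f.
Proof. by apply/esym/popp_uniq; rewrite paddNf. Qed.

Lemma popp0 X Y : popp (pzero X Y) = pzero X Y.
Proof. by apply/esym/popp_uniq; rewrite paddf0. Qed.

Definition zero_object X := pid X = pzero X X.

End PreaddTheory.

Record iso (C : preaddCat) (X Y : C) := Iso {
  iso_hom : phom X Y;
  iso_inv : phom Y X;
  iso_homK : iso_inv ∙ iso_hom = pid X;
  iso_invK : iso_hom ∙ iso_inv = pid Y
}.

Definition isomorphic (C : preaddCat) (X Y : C) := inhabited (iso X Y).

Definition opCat (C : preaddCat) : preaddCat.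
Proof.
refine (@PreaddCat C (fun X Y => @phom C Y X) (@pid C)
  (fun X Y Z g f => f ∙ g) (fun X Y => pzero Y X) (fun X Y => @padd C Y X)
  (fun X Y => @popp C Y X) _ _ _ _ _ _ _ _ _).
- by move=> X Y Z W h g f; rewrite pcompA.
- by move=> X Y f; rewrite pcompf1.
- by move=> X Y f; rewrite pcomp1f.
- by move=> X Y f g h; rewrite paddA.
- by move=> X Y f g; rewrite paddC.
- by move=> X Y f; rewrite padd0f.
- by move=> X Y f; rewrite paddNf.
- by move=> X Y Z g h f; rewrite pcompDr.
- by move=> X Y Z g f h; rewrite pcompDl.
Defined.

Definition fullSub (C : preaddCat) (P : C -> Prop) : preaddCat.
Proof.
refine (@PreaddCat {X : C | P X} (fun X Y => phom (sval X) (sval Y))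
  (fun X => pid (sval X)) (fun X Y Z g f => g ∙ f)
  (fun X Y => pzero (sval X) (sval Y)) (fun X Y => @padd C (sval X) (sval Y))
  (fun X Y => @popp C (sval X) (sval Y)) _ _ _ _ _ _ _ _ _).
- by move=> X Y Z W h g f; rewrite pcompA.
- by move=> X Y f; rewrite pcomp1f.
- by move=> X Y f; rewrite pcompf1.
- by move=> X Y f g h; rewrite paddA.
- by move=> X Y f g; rewrite paddC.
- by move=> X Y f; rewrite padd0f.
- by move=> X Y f; rewrite paddNf.
- by move=> X Y Z g h f; rewrite pcompDl.
- by move=> X Y Z g f h; rewrite pcompDr.
Defined.

(** Covariant additive functors; a contravariant functor from [C] to [D] is a
    [functor (opCat C) D]. *)
Record functor (C D : preaddCat) := Functor {
  fob :> C -> D;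
  fmor : forall X Y, phom X Y -> phom (fob X) (fob Y);
  fmor1 : forall X, fmor (pid X) = pid (fob X);
  fmorM : forall X Y Z (g : phom Y Z) (f : phom X Y),
    fmor (g ∙ f) = fmor g ∙ fmor f;
  fmorD : forall X Y (f g : phom X Y), fmor (padd f g) = padd (fmor f) (fmor g)
}.
Arguments fmor {C D} F {X Y} f : rename.

Definition idFun (C : preaddCat) : functor C C :=
  @Functor C C id (fun _ _ => id) (fun _ => erefl) (fun _ _ _ _ _ => erefl)
    (fun _ _ _ _ => erefl).

Definition compFun (C D E : preaddCat) (G : functor D E) (F : functor C D) :
  functor C E.
Proof.
refine (@Functor C E (fun X => G (F X)) (fun _ _ f => fmor G (fmor F f)) _ _ _).
- by move=> X; rewrite !fmor1.
- by move=> X Y Z g f; rewrite !fmorM.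
- by move=> X Y f g; rewrite !fmorD.
Defined.

Definition opFun (C D : preaddCat) (F : functor C D) :
  functor (opCat C) (opCat D).
Proof.
refine (@Functor (opCat C) (opCat D) F (fun X Y f => fmor F f) _ _ _).
- by move=> X; apply: fmor1.
- by move=> X Y Z g f; apply: fmorM.
- by move=> X Y f g; apply: fmorD.
Defined.

Record natIso (C D : preaddCat) (F G : functor C D) := NatIso {
  ni :> forall X, iso (F X) (G X);
  ni_nat : forall X Y (f : phom X Y),
    iso_hom (ni Y) ∙ fmor F f = fmor G f ∙ iso_hom (ni X)
}.

Section FunctorProperties.
Variables (C D : preaddCat) (F : functor C D).

Definition full :=
  forall (X Y : C) (g : phom (F X) (F Y)), exists f : phom X Y, fmor F f = g.

Definition dense := forall Y : D, exists X : C, isomorphic (F X) Y.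

Definition objective :=
  forall (X Y : C) (f : phom X Y), fmor F f = pzero (F X) (F Y) ->
    exists (K : C) (g : phom X K) (h : phom K Y),
      zero_object (F K) /\ f = h ∙ g.

Definition is_equivalence :=
  exists G : functor D C,
    inhabited (natIso (compFun G F) (idFun C)) /\
    inhabited (natIso (compFun F G) (idFun D)).

End FunctorProperties.

(** A duality from [C] to [D] is a contravariant functor that is an
    equivalence from the opposite of [C] to [D]. *)
Definition is_duality (C D : preaddCat) (F : functor (opCat C) D) :=
  is_equivalence F.

(** * Quotient of a preadditive category by an ideal *)

Record ideal (C : preaddCat) := Ideal {
  in_ideal : forall X Y : C, phom X Y -> Prop;
  ideal0 : forall X Y : C, in_ideal (pzero X Y);
  idealD : forall (X Y : C) (f g : phom X Y),
    in_ideal f -> in_ideal g -> in_ideal (padd f g);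
  idealN : forall (X Y : C) (f : phom X Y), in_ideal f -> in_ideal (popp f);
  idealMl : forall (X Y Z : C) (g : phom Y Z) (f : phom X Y),
    in_ideal f -> in_ideal (g ∙ f);
  idealMr : forall (X Y Z : C) (g : phom Y Z) (f : phom X Y),
    in_ideal g -> in_ideal (g ∙ f)
}.

Section QuotientCategory.
Variables (C : preaddCat) (I : ideal C).
Implicit Types X Y Z : C.

Definition icoset X Y (f : phom X Y) : phom X Y -> Prop :=
  fun g => in_ideal I (padd f (popp g)).

Definition qhom X Y := {c : phom X Y -> Prop | exists f, c = icoset f}.

Definition qpi X Y (f : phom X Y) : qhom X Y :=
  exist _ (icoset f) (ex_intro _ f erefl).

Definition qrepr X Y (c : qhom X Y) : phom X Y := sval (cid (svalP c)).

Lemma qreprK X Y (c : qhom X Y) : qpi (qrepr c) = c.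
Proof.
rewrite /qrepr; case: cid => f /= e.
by case: c e => c ? /= e; apply: eq_exist.
Qed.

Lemma eq_qpi X Y (f g : phom X Y) : in_ideal I (padd f (popp g)) -> qpi f = qpi g.
Proof.
move=> fg; apply: eq_exist; apply/funext => h; apply/propext; split => [fh|gh].
- rewrite /icoset; have -> : padd g (popp h)
    = padd (popp (padd f (popp g))) (padd f (popp h)).
    by rewrite poppD poppK paddACA paddNf padd0f.
  exact/idealD/fh/idealN.
- have : in_ideal I (padd (padd f (popp g)) (padd g (popp h))).
    exact: idealD.
  by rewrite -paddA [padd (popp g) _]paddA paddNf padd0f.
Qed.

Lemma qpi_inj X Y (f g : phom X Y) : qpi f = qpi g -> in_ideal I (padd f (popp g)).
Proof.
move=> /(congr1 sval) /= e.
by rewrite -[in_ideal I _]/(icoset f g) e /icoset paddfN; apply: ideal0.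
Qed.

Lemma qrepr_pi X Y (f : phom X Y) : in_ideal I (padd (qrepr (qpi f)) (popp f)).
Proof. by apply: qpi_inj; rewrite qreprK. Qed.

Definition qcomp X Y Z (g : qhom Y Z) (f : qhom X Y) : qhom X Z :=
  qpi (qrepr g ∙ qrepr f).
Definition qadd X Y (f g : qhom X Y) : qhom X Y :=
  qpi (padd (qrepr f) (qrepr g)).
Definition qopp X Y (f : qhom X Y) : qhom X Y := qpi (popp (qrepr f)).

Lemma qpiM X Y Z (g : phom Y Z) (f : phom X Y) :
  qpi (g ∙ f) = qcomp (qpi g) (qpi f).
Proof.
apply/esym/eq_qpi; set g' := qrepr _; set f' := qrepr _.
have -> : padd (g' ∙ f') (popp (g ∙ f))
   = padd (g' ∙ padd f' (popp f)) (padd g' (popp g) ∙ f).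
  rewrite pcompDr pcompDl pcompfN pcompNf -paddA; congr padd.
  by rewrite paddA paddNf padd0f.
by apply: idealD; [apply/idealMl/qrepr_pi|apply/idealMr/qrepr_pi].
Qed.

Lemma qpiD X Y (f g : phom X Y) : qpi (padd f g) = qadd (qpi f) (qpi g).
Proof.
apply/esym/eq_qpi; rewrite poppD paddACA.
by apply: idealD; apply: qrepr_pi.
Qed.

Lemma qpiN X Y (f : phom X Y) : qpi (popp f) = qopp (qpi f).
Proof. by apply/esym/eq_qpi; rewrite -poppD; apply/idealN/qrepr_pi. Qed.

Definition quotCat : preaddCat.
Proof.
refine (@PreaddCat C qhom (fun X => qpi (pid X)) qcomp
  (fun X Y => qpi (pzero X Y)) qadd qopp _ _ _ _ _ _ _ _ _).
- move=> X Y Z W h g f; rewrite -[h]qreprK -[g]qreprK -[f]qreprK.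
  by rewrite -!qpiM pcompA.
- by move=> X Y f; rewrite -[f]qreprK -qpiM pcomp1f.
- by move=> X Y f; rewrite -[f]qreprK -qpiM pcompf1.
- move=> X Y f g h; rewrite -[h]qreprK -[g]qreprK -[f]qreprK.
  by rewrite -!qpiD paddA.
- by move=> X Y f g; rewrite -[g]qreprK -[f]qreprK -!qpiD paddC.
- by move=> X Y f; rewrite -[f]qreprK -qpiD padd0f.
- by move=> X Y f; rewrite -[f]qreprK -qpiN -qpiD paddNf.
- move=> X Y Z h g f; rewrite -[h]qreprK -[g]qreprK -[f]qreprK.
  by rewrite -qpiD -!qpiM -qpiD pcompDl.
- move=> X Y Z h g f; rewrite -[h]qreprK -[g]qreprK -[f]qreprK.
  by rewrite -qpiD -!qpiM -qpiD pcompDr.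
Defined.

Definition quotFun : functor C quotCat :=
  @Functor C quotCat id qpi (fun _ => erefl) qpiM qpiD.

End QuotientCategory.

(** * Additive categories with hom-groups in [zmodType] *)

Record addCat := AddCat {
  ob :> Type;
  hom : ob -> ob -> zmodType;
  idm : forall X, hom X X;
  comp : forall X Y Z, hom Y Z -> hom X Y -> hom X Z;
  compA : forall X Y Z W (h : hom Z W) (g : hom Y Z) (f : hom X Y),
    comp h (comp g f) = comp (comp h g) f;
  comp1f : forall X Y (f : hom X Y), comp (idm Y) f = f;
  compf1 : forall X Y (f : hom X Y), comp f (idm X) = f;
  compDl : forall X Y Z (g h : hom Y Z) (f : hom X Y),
    comp (g + h) f = comp g f + comp h f;
  compDr : forall X Y Z (g : hom Y Z) (f h : hom X Y),
    comp g (f + h) = comp g f + comp g h;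
  zob : ob;
  zobP : idm zob = 0;
  bip : ob -> ob -> ob;
  in1 : forall X Y, hom X (bip X Y);
  in2 : forall X Y, hom Y (bip X Y);
  pr1 : forall X Y, hom (bip X Y) X;
  pr2 : forall X Y, hom (bip X Y) Y;
  pr1in1 : forall X Y, comp (pr1 X Y) (in1 X Y) = idm X;
  pr2in2 : forall X Y, comp (pr2 X Y) (in2 X Y) = idm Y;
  pr1in2 : forall X Y, comp (pr1 X Y) (in2 X Y) = 0;
  pr2in1 : forall X Y, comp (pr2 X Y) (in1 X Y) = 0;
  in_pr : forall X Y,
    comp (in1 X Y) (pr1 X Y) + comp (in2 X Y) (pr2 X Y) = idm (bip X Y)
}.
Arguments hom {C} X Y : rename.
Arguments idm {C} X : rename.
Arguments zob {C} : rename.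
Arguments bip {C} X Y : rename.
Arguments in1 {C X Y} : rename.
Arguments in2 {C X Y} : rename.
Arguments pr1 {C X Y} : rename.
Arguments pr2 {C X Y} : rename.

Notation "g ∘ f" := (comp g f) (at level 40, left associativity).

Definition preadd_of (C : addCat) : preaddCat :=
  @PreaddCat C (fun X Y => hom X Y) (@idm C) (@comp C) (fun _ _ => 0)
    (fun _ _ => +%R) (fun _ _ => -%R) (@compA C) (@comp1f C) (@compf1 C)
    (fun _ _ => @addrA _) (fun _ _ => @addrC _) (fun _ _ => @add0r _)
    (fun _ _ => @addNr _) (@compDl C) (@compDr C).

Section AddTheory.
Variable C : addCat.
Implicit Types X Y Z : C.

Lemma compf0 X Y Z (g : hom Y Z) : g ∘ (0 : hom X Y) = 0.
Proof. exact: (@pcompf0 (preadd_of C)). Qed.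

Lemma comp0f X Y Z (f : hom X Y) : (0 : hom Y Z) ∘ f = 0.
Proof. exact: (@pcomp0f (preadd_of C)). Qed.

Lemma compNf X Y Z (g : hom Y Z) (f : hom X Y) : (- g) ∘ f = - (g ∘ f).
Proof. exact: (@pcompNf (preadd_of C)). Qed.

Lemma compfN X Y Z (g : hom Y Z) (f : hom X Y) : g ∘ (- f) = - (g ∘ f).
Proof. exact: (@pcompfN (preadd_of C)). Qed.

Lemma compBl X Y Z (g h : hom Y Z) (f : hom X Y) :
  (g - h) ∘ f = g ∘ f - h ∘ f.
Proof. by rewrite compDl compNf. Qed.

Lemma compBr X Y Z (g : hom Y Z) (f h : hom X Y) :
  g ∘ (f - h) = g ∘ f - g ∘ h.
Proof. by rewrite compDr compfN. Qed.

Definition isZero X := idm X = 0.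

Lemma hom_to_zero X Y (f : hom X Y) : isZero Y -> f = 0.
Proof. by move=> Y0; rewrite -(comp1f f) Y0 comp0f. Qed.

Lemma hom_from_zero X Y (f : hom X Y) : isZero X -> f = 0.
Proof. by move=> X0; rewrite -(compf1 f) X0 compf0. Qed.

Definition bipmap X Y X' Y' (f : hom X X') (g : hom Y Y') :
  hom (bip X Y) (bip X' Y') := in1 ∘ f ∘ pr1 + in2 ∘ g ∘ pr2.

Lemma pr1_bipmap X Y X' Y' (f : hom X X') (g : hom Y Y') :
  pr1 ∘ bipmap f g = f ∘ pr1.
Proof. by rewrite compDr !compA pr1in1 pr1in2 comp1f !comp0f addr0. Qed.

Lemma pr2_bipmap X Y X' Y' (f : hom X X') (g : hom Y Y') :
  pr2 ∘ bipmap f g = g ∘ pr2.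
Proof. by rewrite compDr !compA pr2in2 pr2in1 comp1f !comp0f add0r. Qed.

Lemma bipmap_in1 X Y X' Y' (f : hom X X') (g : hom Y Y') :
  bipmap f g ∘ in1 = in1 ∘ f.
Proof. by rewrite compDl -!compA pr1in1 pr2in1 compf1 !compf0 addr0. Qed.

Lemma bipmap_in2 X Y X' Y' (f : hom X X') (g : hom Y Y') :
  bipmap f g ∘ in2 = in2 ∘ g.
Proof. by rewrite compDl -!compA pr2in2 pr1in2 compf1 !compf0 add0r. Qed.

Lemma to_bip_ext Z X Y (f g : hom Z (bip X Y)) :
  pr1 ∘ f = pr1 ∘ g -> pr2 ∘ f = pr2 ∘ g -> f = g.
Proof.
move=> e1 e2; rewrite -(comp1f f) -(comp1f g) -in_pr !compDl -!compA.
by rewrite e1 e2.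
Qed.

Lemma from_bip_ext Z X Y (f g : hom (bip X Y) Z) :
  f ∘ in1 = g ∘ in1 -> f ∘ in2 = g ∘ in2 -> f = g.
Proof.
move=> e1 e2; rewrite -(compf1 f) -(compf1 g) -in_pr !compDr !compA.
by rewrite e1 e2.
Qed.

Definition diag X : hom X (bip X X) := in1 + in2.
Definition codiag X : hom (bip X X) X := pr1 + pr2.

End AddTheory.

(** * Complexes *)

Section Complexes.
Variable C : addCat.

Record cplx := Cplx {
  cob :> nat -> C;
  cd : forall i, hom (cob i) (cob i.+1);
  cdd : forall i, cd i.+1 ∘ cd i = 0
}.

Record cmap (X Y : cplx) := Cmap {
  cm :> forall i, hom (X i) (Y i);
  cmP : forall i, cm i.+1 ∘ cd X i = cd Y i ∘ cm i
}.

Lemma cmap_ext X Y (f g : cmap X Y) : (forall i, f i = g i) -> f = g.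
Proof.
case: f g => f fP [g gP] /= e.
have {}e : f = g by apply: functional_extensionality_dep.
by move: fP gP; rewrite e => fP gP; congr Cmap; apply: Prop_irrelevance.
Qed.

Lemma cmap1P (X : cplx) i : idm (X i.+1) ∘ cd X i = cd X i ∘ idm (X i).
Proof. by rewrite comp1f compf1. Qed.
Definition cmap1 (X : cplx) : cmap X X := Cmap (@cmap1P X).

Lemma cmap_compP X Y Z (g : cmap Y Z) (f : cmap X Y) i :
  (g i.+1 ∘ f i.+1) ∘ cd X i = cd Z i ∘ (g i ∘ f i).
Proof. by rewrite -compA cmP compA cmP compA. Qed.
Definition cmap_comp X Y Z (g : cmap Y Z) (f : cmap X Y) : cmap X Z :=
  Cmap (cmap_compP g f).

Lemma cmap0P (X Y : cplx) i :
  (0 : hom (X i.+1) (Y i.+1)) ∘ cd X i = cd Y i ∘ 0.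
Proof. by rewrite comp0f compf0. Qed.
Definition cmap0 X Y : cmap X Y := Cmap (@cmap0P X Y).

Lemma cmap_addP X Y (f g : cmap X Y) i :
  (f i.+1 + g i.+1) ∘ cd X i = cd Y i ∘ (f i + g i).
Proof. by rewrite compDl compDr !cmP. Qed.
Definition cmap_add X Y (f g : cmap X Y) : cmap X Y := Cmap (cmap_addP f g).

Lemma cmap_oppP X Y (f : cmap X Y) i :
  (- f i.+1) ∘ cd X i = cd Y i ∘ (- f i).
Proof. by rewrite compNf compfN cmP. Qed.
Definition cmap_opp X Y (f : cmap X Y) : cmap X Y := Cmap (cmap_oppP f).

Definition cplxCat : preaddCat.
Proof.
refine (@PreaddCat cplx cmap cmap1 cmap_comp cmap0 cmap_add cmap_opp
  _ _ _ _ _ _ _ _ _); move=> *; apply: cmap_ext => i /=.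
- exact: compA.
- exact: comp1f.
- exact: compf1.
- exact: addrA.
- exact: addrC.
- exact: add0r.
- exact: addNr.
- exact: compDl.
- exact: compDr.
Defined.

Definition null_homotopic X Y (f : cmap X Y) : Prop :=
  exists h : forall i, hom (X i.+1) (Y i),
    f 0%N = h 0%N ∘ cd X 0 /\
    forall i, f i.+1 = cd Y i ∘ h i + h i.+1 ∘ cd X i.+1.

(** [X] is concentrated in degrees [0, ..., m]. *)
Definition bounded m (X : cplx) := forall i, (m < i)%N -> isZero (X i).

(** 0 -> Hom(Z, X^0) -> ... -> Hom(Z, X^n) -> Hom(Z, X^{n+1}) is exact. *)
Definition cov_exact n (X : cplx) :=
  (forall Z (g : hom Z (X 0%N)), cd X 0 ∘ g = 0 -> g = 0) /\
  (forall i, (i < n)%N -> forall Z (g : hom Z (X i.+1)),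
     cd X i.+1 ∘ g = 0 -> exists h : hom Z (X i), g = cd X i ∘ h).

(** 0 -> Hom(X^{n+1}, Z) -> ... -> Hom(X^1, Z) -> Hom(X^0, Z) is exact. *)
Definition con_exact n (X : cplx) :=
  (forall Z (g : hom (X n.+1) Z), g ∘ cd X n = 0 -> g = 0) /\
  (forall i, (i < n)%N -> forall Z (g : hom (X i.+1) Z),
     g ∘ cd X i = 0 -> exists h : hom (X i.+2) Z, g = h ∘ cd X i.+1).

(** n-exact sequences 0 -> X^0 -> ... -> X^{n+1} -> 0, seen as complexes
    extended by zero objects in the degrees above n + 1. *)
Definition n_exact n (X : cplx) :=
  [/\ bounded n.+1 X, cov_exact n X & con_exact n X].

(** ** Direct sums, truncations, shifts and mapping cones *)

Lemma dsum_cdd (X Y : cplx) i :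
  bipmap (cd X i.+1) (cd Y i.+1) ∘ bipmap (cd X i) (cd Y i) = 0.
Proof.
apply: to_bip_ext; rewrite compf0 compA.
  by rewrite pr1_bipmap -compA pr1_bipmap compA cdd comp0f.
by rewrite pr2_bipmap -compA pr2_bipmap compA cdd comp0f.
Qed.
Definition dsum X Y : cplx := Cplx (dsum_cdd X Y).

Lemma isZero_bip (A B : C) : isZero A -> isZero B -> isZero (bip A B).
Proof.
move=> A0 B0; rewrite /isZero -in_pr.
by rewrite (hom_from_zero in1 A0) (hom_from_zero in2 B0) !comp0f addr0.
Qed.

Lemma dsum_n_exact n X Y : n_exact n X -> n_exact n Y -> n_exact n (dsum X Y).
Proof.
move=> [bX [vX0 vX] [nX0 nX]] [bY [vY0 vY] [nY0 nY]]; split.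
- by move=> i ni; apply: isZero_bip; [apply: bX|apply: bY].
- split=> [Z g /= e|i ni Z g /= e].
    apply: to_bip_ext; rewrite compf0.
      by apply: vX0; rewrite compA -(pr1_bipmap _ (cd Y 0)) -compA e compf0.
    by apply: vY0; rewrite compA -(pr2_bipmap (cd X 0)) -compA e compf0.
  have [|h1 e1] := vX i ni Z (pr1 ∘ g).
    by rewrite compA -(pr1_bipmap _ (cd Y i.+1)) -compA e compf0.
  have [|h2 e2] := vY i ni Z (pr2 ∘ g).
    by rewrite compA -(pr2_bipmap (cd X i.+1)) -compA e compf0.
  exists (in1 ∘ h1 + in2 ∘ h2).
  rewrite compDr !compA bipmap_in1 bipmap_in2 -!compA -e1 -e2 !compA -compDl.
  by rewrite in_pr comp1f.
- split=> [Z g /= e|i ni Z g /= e].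
    apply: from_bip_ext; rewrite comp0f.
      by apply: nX0; rewrite -compA -(bipmap_in1 _ (cd Y n)) compA e comp0f.
    by apply: nY0; rewrite -compA -(bipmap_in2 (cd X n)) compA e comp0f.
  have [|h1 e1] := nX i ni Z (g ∘ in1).
    by rewrite -compA -(bipmap_in1 _ (cd Y i)) compA e comp0f.
  have [|h2 e2] := nY i ni Z (g ∘ in2).
    by rewrite -compA -(bipmap_in2 (cd X i)) compA e comp0f.
  exists (h1 ∘ pr1 + h2 ∘ pr2).
  rewrite compDl -!compA pr1_bipmap pr2_bipmap !compA -e1 -e2 -!compA -compDr.
  by rewrite in_pr compf1.
Qed.

Definition cut (A B : C) (b c : bool) (f : hom A B) :
    hom (if b then A else zob) (if c then B else zob) :=
  match b, c with true, true => f | _, _ => 0 end.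

Lemma trunc_cdd n (X : cplx) i :
  cut (i.+1 <= n)%N (i.+2 <= n)%N (cd X i.+1)
    ∘ cut (i <= n)%N (i.+1 <= n)%N (cd X i) = 0.
Proof.
move: (i <= n)%N (i.+1 <= n)%N (i.+2 <= n)%N => [] [] [] /=;
  by rewrite ?compf0 ?comp0f ?cdd.
Qed.
(** X^0 -> ... -> X^n -> 0 *)
Definition trunc n X : cplx := Cplx (@trunc_cdd n X).

Lemma trunc_mapP n X Y (f : cmap X Y) i :
  cut (i.+1 <= n)%N (i.+1 <= n)%N (f i.+1) ∘ cd (trunc n X) i
    = cd (trunc n Y) i ∘ cut (i <= n)%N (i <= n)%N (f i).
Proof.
rewrite /=; move: (i <= n)%N (i.+1 <= n)%N => [] [] /=;
  by rewrite ?compf0 ?comp0f ?cmP.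
Qed.
Definition trunc_map n X Y (f : cmap X Y) : cmap (trunc n X) (trunc n Y) :=
  @Cmap (trunc n X) (trunc n Y) (fun i => cut (i <= n)%N (i <= n)%N (f i))
    (trunc_mapP n f).

(** X^1 -> X^2 -> ... with X^1 in degree 0 *)
Definition shift (X : cplx) : cplx := Cplx (fun i => cdd X i.+1).
Definition shift_map X Y (f : cmap X Y) : cmap (shift X) (shift Y) :=
  @Cmap (shift X) (shift Y) (fun i => f i.+1) (fun i => cmP f i.+1).

Section Cone.
Variables (X Y : cplx) (f : cmap X Y).

Definition cone_ob i : C := if i is j.+1 then bip (X i) (Y j) else X 0%N.

Definition cone_d i : hom (cone_ob i) (cone_ob i.+1) :=
  match i with
  | 0 => - (in1 ∘ cd X 0) + in2 ∘ f 0%N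
  | j.+1 => - (in1 ∘ cd X j.+1 ∘ pr1) + in2 ∘ (f j.+1 ∘ pr1 + cd Y j ∘ pr2)
  end.

Lemma pr1_cone_d j : pr1 ∘ cone_d j.+1 = - (cd X j.+1 ∘ pr1).
Proof.
by rewrite /= (compDr pr1) compfN !compA pr1in1 pr1in2 comp0f addr0 comp1f.
Qed.

Lemma pr2_cone_d j : pr2 ∘ cone_d j.+1 = f j.+1 ∘ pr1 + cd Y j ∘ pr2.
Proof.
by rewrite /= (compDr pr2) compfN !compA pr2in1 pr2in2 !comp0f oppr0 add0r comp1f.
Qed.

Lemma cone_cdd i : cone_d i.+1 ∘ cone_d i = 0.
Proof.
have e1 : pr1 ∘ cone_d 0%N = - cd X 0.
  by rewrite /= (compDr pr1) compfN !compA pr1in1 pr1in2 comp0f addr0 comp1f.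
have e2 : pr2 ∘ cone_d 0%N = f 0%N.
  by rewrite /= (compDr pr2) compfN !compA pr2in1 pr2in2 !comp0f oppr0 add0r comp1f.
apply: to_bip_ext; rewrite compf0 compA ?pr1_cone_d ?pr2_cone_d.
  case: i => [|i]; rewrite compNf -compA ?e1 ?pr1_cone_d compfN ?compA cdd.
    by rewrite !oppr0.
  by rewrite comp0f !oppr0.
rewrite compDl -!compA; case: i => [|i].
  by rewrite e1 e2 compfN cmP addNr.
rewrite pr1_cone_d pr2_cone_d compfN compDr !compA cdd comp0f addr0 cmP.
by rewrite addNr.
Qed.

(** X^0 -> X^1 (+) Y^0 -> X^2 (+) Y^1 -> ..., with differential
    (x, y) |-> (- d x, f x + d y) and X^0 in degree 0 *)
Definition cone : cplx := Cplx cone_cdd.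

End Cone.

End Complexes.
Arguments cd {C} X i : rename.

(** * Yoneda extensions *)

Section Extensions.
Variables (n : nat) (C : addCat).
Implicit Types L N : C.

(** n-exact sequences from [L] to [N], i.e. 0 -> L -> E^1 -> ... -> E^n ->
    N -> 0; the end terms are identified with [L] and [N] by isomorphisms. *)
Record ext (N L : C) := Ext {
  ecplx :> cplx C;
  ecplxP : n_exact n ecplx;
  eleft : iso (L : preadd_of C) (ecplx 0%N);
  eright : iso (ecplx n.+1 : preadd_of C) N
}.

(** [f] is a morphism of n-exact sequences inducing [a] and [b] on the ends. *)
Definition ends N L N' L' (E : ext N L) (E' : ext N' L') (f : cmap E E')
    (a : hom L L') (b : hom N N') : Prop :=
  f 0%N ∘ iso_hom (eleft E) = iso_hom (eleft E') ∘ a /\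
  iso_hom (eright E') ∘ f n.+1 = b ∘ iso_hom (eright E).

Definition yoneda_step N L (E E' : ext N L) : Prop :=
  exists f : cmap E E', ends f (idm L) (idm N).

Definition yoneda_eq N L : ext N L -> ext N L -> Prop :=
  clos_refl_sym_trans _ (@yoneda_step N L).

(** The Yoneda classes of n-exact sequences from [L] to [N]. *)
Definition Extn N L := {c : ext N L -> Prop | exists E, c = yoneda_eq E}.

Definition ext_class N L (E : ext N L) : Extn N L :=
  exist _ (yoneda_eq E) (ex_intro _ E erefl).

(** [E'] is an n-pushout of [E] along [a]: the complex
    E^0 -> E^1 (+) E'^0 -> ... -> E^n (+) E'^{n-1} -> E'^n
    exhibits an n-cokernel of its first map. *)
Definition n_pushout N L L' (a : hom L L') (E : ext N L) (E' : ext N L') :=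
  exists f : cmap E E',
    ends f a (idm N) /\ con_exact n (cone (trunc_map n f)).

(** Dually, [E'] is an n-pullback of [E] along [b]: the complex
    E'^1 -> E'^2 (+) E^1 -> ... -> E'^{n+1} (+) E^n -> E^{n+1}
    exhibits an n-kernel of its last map. *)
Definition n_pullback N N' L (b : hom N' N) (E : ext N L) (E' : ext N' L) :=
  exists f : cmap E' E,
    ends f (idm L) b /\ cov_exact n (cone (shift_map f)).

Definition bip_iso (A B A' B' : C) (i : iso (A : preadd_of C) A')
  (j : iso (B : preadd_of C) B') : iso (bip A B : preadd_of C) (bip A' B').
Proof.
refine (@Iso (preadd_of C) (bip A B) (bip A' B')
  (bipmap (iso_hom i) (iso_hom j)) (bipmap (iso_inv i) (iso_inv j)) _ _).
- have e1 := iso_homK i; have e2 := iso_homK j; move: e1 e2 => /= e1 e2.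
  apply: to_bip_ext; rewrite compf1 compA ?pr1_bipmap ?pr2_bipmap -compA.
    by rewrite pr1_bipmap compA e1 comp1f.
  by rewrite pr2_bipmap compA e2 comp1f.
- have e1 := iso_invK i; have e2 := iso_invK j; move: e1 e2 => /= e1 e2.
  apply: to_bip_ext; rewrite compf1 compA ?pr1_bipmap ?pr2_bipmap -compA.
    by rewrite pr1_bipmap compA e1 comp1f.
  by rewrite pr2_bipmap compA e2 comp1f.
Defined.

Definition ext_dsum N L N' L' (E : ext N L) (E' : ext N' L') :
    ext (bip N N') (bip L L') :=
  @Ext _ _ (dsum E E') (dsum_n_exact (ecplxP E) (ecplxP E'))
    (bip_iso (eleft E) (eleft E')) (bip_iso (eright E) (eright E')).

(** [E] represents the Baer sum of the classes of [E1] and [E2]: it is obtained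
    from their direct sum by an n-pushout along the codiagonal of [L] followed
    by an n-pullback along the diagonal of [N]. *)
Definition baer_sum N L (E1 E2 E : ext N L) : Prop :=
  exists P : ext (bip N N) L,
    n_pushout (codiag L) (ext_dsum E1 E2) P /\ n_pullback (diag N) P E.

(** Additive sub-bifunctors of Ext^n(-,-). The zero element of Ext^n(N,L) is
    the class of any contractible n-exact sequence; stability under opposites
    is stability under n-pushouts along -1. *)
Record addSubfunctor := AddSubfunctor {
  subF :> forall N L, Extn N L -> Prop;
  subF_pushout : forall N L L' (a : hom L L') (E : ext N L) (E' : ext N L'),
    n_pushout a E E' -> subF (ext_class E) -> subF (ext_class E');
  subF_pullback : forall N N' L (b : hom N' N) (E : ext N L) (E' : ext N' L),
    n_pullback b E E' -> subF (ext_class E) -> subF (ext_class E');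
  subF_zero : forall N L (E : ext N L),
    null_homotopic (cmap1 E) -> subF (ext_class E);
  subF_baer : forall N L (E1 E2 E : ext N L),
    baer_sum E1 E2 E ->
    subF (ext_class E1) -> subF (ext_class E2) -> subF (ext_class E)
}.

Definition idIso (D : preaddCat) (X : D) : iso X X :=
  Iso (pcomp1f (pid X)) (pcomp1f (pid X)).

Definition ext_of (X : cplx C) (hX : n_exact n X) : ext (X n.+1) (X 0%N) :=
  @Ext _ _ X hX (idIso (X 0%N : preadd_of C)) (idIso (X n.+1 : preadd_of C)).

Definition F_exact (F : addSubfunctor) (X : cplx C) : Prop :=
  exists hX : n_exact n X, F _ _ (ext_class (ext_of hX)).

End Extensions.

(** * The categories E_F(M), its homotopy category, and F_F(M) *)

Section FExactSequences.
Variables (n : nat) (C : addCat) (F : addSubfunctor n C).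

Definition exactCat : preaddCat := @fullSub (cplxCat C) (F_exact F).

Definition null_homotopic_ideal : ideal exactCat.
Proof.
refine (@Ideal exactCat
  (fun X Y f => @null_homotopic C (sval X) (sval Y) f) _ _ _ _ _).
- move=> X Y; exists (fun=> 0); split=> [|i] /=; first by rewrite comp0f.
  by rewrite comp0f compf0 addr0.
- move=> X Y f g [h [h0 hS]] [k [k0 kS]]; exists (fun i => h i + k i).
  split=> [|i] /=; first by rewrite h0 k0 compDl.
  by rewrite hS kS compDl compDr addrACA.
- move=> X Y f [h [h0 hS]]; exists (fun i => - h i).
  split=> [|i] /=; first by rewrite h0 compNf.
  by rewrite hS compNf compfN opprD.
- move=> X Y Z g f [h [h0 hS]]; exists (fun i => (g : cmap _ _) i ∘ h i).
  split=> [|i] /=; first by rewrite h0 compA.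
  by rewrite hS compDr !compA cmP.
- move=> X Y Z g f [h [h0 hS]]; exists (fun i => h i ∘ (f : cmap _ _) i.+1).
  split=> [|i] /=; first by rewrite h0 -!compA cmP.
  by rewrite hS compDl -!compA cmP.
Defined.

Definition htpyCat : preaddCat := quotCat null_homotopic_ideal.
Definition htpyFun : functor exactCat htpyCat := quotFun null_homotopic_ideal.

End FExactSequences.

Section ArrowCategory.
Variable C : addCat.

Record arrow := Arrow { asrc : C; atgt : C; amap : hom asrc atgt }.

Record square (f g : arrow) := Square {
  sq1 : hom (asrc f) (asrc g);
  sq2 : hom (atgt f) (atgt g);
  sqP : sq2 ∘ amap f = amap g ∘ sq1
}.

Lemma square_ext f g (a b : square f g) :
  sq1 a = sq1 b -> sq2 a = sq2 b -> a = b.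
Proof.
case: a b => a1 a2 aP [b1 b2 bP] /= e1 e2; move: aP bP; rewrite e1 e2.
by move=> aP bP; congr Square; apply: Prop_irrelevance.
Qed.

Lemma square1P f : idm (atgt f) ∘ amap f = amap f ∘ idm (asrc f).
Proof. by rewrite comp1f compf1. Qed.
Lemma square_compP f g h (b : square g h) (a : square f g) :
  (sq2 b ∘ sq2 a) ∘ amap f = amap h ∘ (sq1 b ∘ sq1 a).
Proof. by rewrite -compA sqP compA sqP compA. Qed.
Lemma square0P f g : (0 : hom _ (atgt g)) ∘ amap f = amap g ∘ 0.
Proof. by rewrite comp0f compf0. Qed.
Lemma square_addP f g (a b : square f g) :
  (sq2 a + sq2 b) ∘ amap f = amap g ∘ (sq1 a + sq1 b).
Proof. by rewrite compDl compDr !sqP. Qed.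
Lemma square_oppP f g (a : square f g) :
  (- sq2 a) ∘ amap f = amap g ∘ (- sq1 a).
Proof. by rewrite compNf compfN sqP. Qed.

Definition arrowCat : preaddCat.
Proof.
refine (@PreaddCat arrow square (fun f => Square (square1P f))
  (fun f g h b a => Square (square_compP b a))
  (fun f g => Square (square0P f g))
  (fun f g a b => Square (square_addP a b))
  (fun f g a => Square (square_oppP a)) _ _ _ _ _ _ _ _ _);
  move=> *; apply: square_ext => /=.
1,2: exact: compA.
1,2: exact: comp1f.
1,2: exact: compf1.
1,2: exact: addrA.
1,2: exact: addrC.
1,2: exact: add0r.
1,2: exact: addNr.
1,2: exact: compDl.
1,2: exact: compDr.
Defined.

Definition last_arrow n (X : cplx C) : arrow := Arrow (cd X n).

Definition last_square n X Y (f : cmap X Y) :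
    square (last_arrow n X) (last_arrow n Y) :=
  @Square (last_arrow n X) (last_arrow n Y) (f n) (f n.+1) (cmP f n).

End ArrowCategory.

(** * Functors to abelian groups *)

Section FunctorCategory.
Variable C : addCat.

Record abFun := AbFun {
  afob :> C -> zmodType;
  afmor : forall X Y, hom X Y -> afob X -> afob Y;
  afmorD : forall X Y (f : hom X Y), {morph afmor f : x y / x + y};
  afmor_add : forall X Y (f g : hom X Y) x,
    afmor (f + g) x = afmor f x + afmor g x;
  afmor1 : forall X x, afmor (idm X) x = x;
  afmorM : forall X Y Z (g : hom Y Z) (f : hom X Y) x,
    afmor (g ∘ f) x = afmor g (afmor f x)
}.

Record natTrans (G H : abFun) := NatTrans {
  nt :> forall X, G X -> H X;
  ntD : forall X, {morph @nt X : x y / x + y};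
  ntP : forall X Y (f : hom X Y) x, nt (afmor f x) = afmor f (nt x)
}.

Lemma natTrans_ext G H (a b : natTrans G H) :
  (forall X (x : G X), a X x = b X x) -> a = b.
Proof.
case: a b => a aD aP [b bD bP] /= e.
have {}e : a = b.
  by apply: functional_extensionality_dep => X; apply/funext => x; apply: e.
move: aD aP bD bP; rewrite e => aD aP bD bP.
by congr NatTrans; apply: Prop_irrelevance.
Qed.

Lemma ntN G H (a : natTrans G H) X (x : G X) : a X (- x) = - a X x.
Proof.
have a0 : a X 0 = 0 by apply: (addrI (a X 0)); rewrite -ntD !addr0.
by apply: (addrI (a X x)); rewrite -ntD !subrr.
Qed.

Definition nat1 G : natTrans G G :=
  @NatTrans G G (fun X => id) (fun _ _ _ => erefl) (fun _ _ _ _ => erefl).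

Definition nat_comp G H K (b : natTrans H K) (a : natTrans G H) : natTrans G K.
Proof.
refine (@NatTrans G K (fun X x => b X (a X x)) _ _).
- by move=> X x y; rewrite !ntD.
- by move=> X Y f x; rewrite !ntP.
Defined.

Lemma afmor0 (G : abFun) X Y (f : hom X Y) : afmor f (0 : G X) = 0.
Proof. by apply: (addrI (afmor f (0 : G X))); rewrite -afmorD !addr0. Qed.

Lemma afmorN (G : abFun) X Y (f : hom X Y) (x : G X) :
  afmor f (- x) = - afmor f x.
Proof.
by apply: (addrI (afmor f x)); rewrite -afmorD !subrr afmor0.
Qed.

Definition nat0 G H : natTrans G H.
Proof.
refine (@NatTrans G H (fun X x => 0) _ _).
- by move=> X x y; rewrite addr0.
- by move=> X Y f x; rewrite afmor0.
Defined.

Definition nat_add G H (a b : natTrans G H) : natTrans G H.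
Proof.
refine (@NatTrans G H (fun X x => a X x + b X x) _ _).
- by move=> X x y; rewrite !ntD addrACA.
- by move=> X Y f x; rewrite !ntP afmorD.
Defined.

Definition nat_opp G H (a : natTrans G H) : natTrans G H.
Proof.
refine (@NatTrans G H (fun X x => - a X x) _ _).
- by move=> X x y; rewrite ntD opprD.
- by move=> X Y f x; rewrite ntP afmorN.
Defined.

Definition funCat : preaddCat.
Proof.
refine (@PreaddCat abFun natTrans nat1 nat_comp nat0 nat_add nat_opp
  _ _ _ _ _ _ _ _ _); move=> *; apply: natTrans_ext => U u /=; first by [].
- by [].
- by [].
- exact: addrA.
- exact: addrC.
- exact: add0r.
- exact: addNr.
- by [].
- exact: ntD.
Defined.

(** ** The functor Coker(C(Y,-) -> C(X,-)) for f : X -> Y *)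

Section Coker.
Variables (X Y : C) (f : hom X Y).
Implicit Types Z W : C.

Definition coker_rel Z (h : hom X Z) : bool :=
  `[< exists g : hom Y Z, h = g ∘ f >].

Lemma coker_rel_closed Z : zmod_closed (@coker_rel Z).
Proof.
split=> [|h k /asboolP[g ->] /asboolP[g' ->]]; apply/asboolP.
  by exists 0; rewrite comp0f.
by exists (g - g'); rewrite compBl.
Qed.

HB.instance Definition _ Z :=
  GRing.isZmodClosed.Build (hom X Z) (@coker_rel Z) (@coker_rel_closed Z).

Definition coker_im Z : zmodClosed (hom X Z) :=
  GRing.ZmodClosed.clone (hom X Z) (@coker_rel Z) _.

Definition coker_ob Z : zmodType := {quot (coker_im Z)}.
Definition coker_pi Z (h : hom X Z) : coker_ob Z := \pi_({quot (coker_im Z)})%qT h.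
Definition coker_repr Z (x : coker_ob Z) : hom X Z :=
  repr (x : {quot (coker_im Z)}).

Lemma coker_reprK Z (x : coker_ob Z) : coker_pi (coker_repr x) = x.
Proof. exact: reprK. Qed.

Lemma coker_piD Z (h k : hom X Z) :
  coker_pi (h + k) = coker_pi h + coker_pi k.
Proof. exact: (@Quotient.pi_add _ (coker_im Z) h k). Qed.

Lemma coker_piP Z (h k : hom X Z) :
  coker_pi h = coker_pi k <-> exists g : hom Y Z, h - k = g ∘ f.
Proof.
split=> [/eqP|[g e]].
  by rewrite -[_ == _](idealrBE (coker_im Z)) => /asboolP.
by apply/eqP; rewrite -[_ == _](idealrBE (coker_im Z)); apply/asboolP; exists g.
Qed.

Definition coker_mor Z W (u : hom Z W) (x : coker_ob Z) : coker_ob W :=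
  coker_pi (u ∘ coker_repr x).

Lemma coker_mor_pi Z W (u : hom Z W) (h : hom X Z) :
  coker_mor u (coker_pi h) = coker_pi (u ∘ h).
Proof.
apply/coker_piP; rewrite -compBr.
have /coker_piP[g ->] := coker_reprK (coker_pi h).
by exists (u ∘ g); rewrite compA.
Qed.

Definition coker : abFun.
Proof.
refine (@AbFun coker_ob coker_mor _ _ _ _).
- move=> Z W u x y; rewrite -[x]coker_reprK -[y]coker_reprK.
  by rewrite -coker_piD !coker_mor_pi -coker_piD compDr.
- move=> Z W u v x; rewrite -[x]coker_reprK.
  by rewrite !coker_mor_pi -coker_piD compDl.
- by move=> Z x; rewrite -[x]coker_reprK coker_mor_pi comp1f.
- move=> Z W V v u x; rewrite -[x]coker_reprK.
  by rewrite !coker_mor_pi compA.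
Defined.

End Coker.

Section CokerMap.
Variables (X Y : cplx C) (f : cmap X Y).

Definition coker_map_fun Z (x : coker (cd Y 0) Z) : coker (cd X 0) Z :=
  coker_pi (cd X 0) (coker_repr x ∘ f 0%N).

Lemma coker_map_pi Z (h : hom (Y 0%N) Z) :
  @coker_map_fun Z (coker_pi (cd Y 0) h) = coker_pi (cd X 0) (h ∘ f 0%N).
Proof.
apply/coker_piP; rewrite -compBl.
have /coker_piP[g ->] := coker_reprK (coker_pi (cd Y 0) h).
by exists (g ∘ f 1%N); rewrite -!compA cmP.
Qed.

(** The map Coker(C(Y^1,-) -> C(Y^0,-)) -> Coker(C(X^1,-) -> C(X^0,-)) induced
    by a morphism of complexes from X to Y. *)
Definition coker_map : natTrans (coker (cd Y 0)) (coker (cd X 0)).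
Proof.
refine (@NatTrans (coker (cd Y 0)) (coker (cd X 0)) coker_map_fun _ _).
- move=> Z x y; rewrite -[x]coker_reprK -[y]coker_reprK.
  by rewrite -coker_piD !coker_map_pi -coker_piD compDl.
- move=> Z W u x; rewrite -[x]coker_reprK.
  by rewrite coker_map_pi /= !coker_mor_pi coker_map_pi compA.
Defined.

End CokerMap.

Lemma eq_coker_map X Y (f g : cmap X Y) :
  (exists h : hom (X 1%N) (Y 0%N), f 0%N - g 0%N = h ∘ cd X 0) ->
  coker_map f = coker_map g.
Proof.
move=> [h e]; apply: natTrans_ext => Z x; rewrite -[x]coker_reprK /=.
rewrite !coker_map_pi; apply/coker_piP; rewrite -compBr e.
by exists (coker_repr x ∘ h); rewrite compA.
Qed.

Lemma coker_map1 X : coker_map (cmap1 X) = nat1 (coker (cd X 0)).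
Proof.
apply: natTrans_ext => Z x; rewrite -[x]coker_reprK /=.
by rewrite coker_map_pi compf1.
Qed.

Lemma coker_mapM X Y Z (g : cmap Y Z) (f : cmap X Y) :
  coker_map (cmap_comp g f) = nat_comp (coker_map f) (coker_map g).
Proof.
apply: natTrans_ext => W x; rewrite -[x]coker_reprK /=.
by rewrite !coker_map_pi compA.
Qed.

Lemma coker_mapD X Y (f g : cmap X Y) :
  coker_map (cmap_add f g) = nat_add (coker_map f) (coker_map g).
Proof.
apply: natTrans_ext => W x; rewrite -[x]coker_reprK /=.
by rewrite !coker_map_pi -coker_piD compDr.
Qed.

(** C-mod *)
Definition fin_presented (G : abFun) : Prop :=
  exists (X Y : C) (f : hom X Y), @isomorphic funCat G (coker f).

Definition fpCat : preaddCat := @fullSub funCat fin_presented.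

End FunctorCategory.

(** * Lifting squares to morphisms of n-kernels *)

Section Lifting.
Variables (n : nat) (C : addCat).

(** An n-kernel X^0 -> ... -> X^{n-1} of [f], recorded as the complex
    0 -> X^0 -> ... -> X^n -> X^{n+1} -> 0 whose last map is identified
    with [f]. *)
Record nker (f : arrow C) := Nker {
  nk :> cplx C;
  nk_bounded : bounded n.+1 nk;
  nk_exact : cov_exact n nk;
  nk_last : iso (last_arrow n nk : arrowCat C) f
}.

Lemma lift_down (X Y : cplx C) : cov_exact n Y ->
  forall j, (j <= n)%N -> forall (a : hom (X j) (Y j)) (b : hom (X j.+1) (Y j.+1)),
  b ∘ cd X j = cd Y j ∘ a ->
  exists p : forall i, hom (X i) (Y i),
    [/\ p j.+1 = b, p j = a &
        forall i, (i <= j)%N -> p i.+1 ∘ cd X i = cd Y i ∘ p i].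
Proof.
move=> [_ ex]; elim=> [|j IH] jn a b ab.
  pose T (i : nat) : Type := hom (X i) (Y i).
  pose p0 : forall i, T i := @dfwith nat T (fun i => 0) 0%N a.
  exists (@dfwith nat T p0 1%N b); rewrite /p0; rewrite dfwith_in dfwith_out // dfwith_in.
  split=> // [[]] // _.
  by rewrite dfwith_in dfwith_out // dfwith_in.
have [|a' ea] := ex j jn _ (a ∘ cd X j).
  by rewrite compA -ab -compA cdd compf0.
have [p [p1 p2 p3]] := IH (ltnW jn) a' a ea.
exists (@dfwith nat (fun i => hom (X i) (Y i) : Type) p j.+2 b); rewrite dfwith_in dfwith_out ?p1 ?neq_ltn ?ltnSn ?orbT //.
split=> // i; rewrite leq_eqVlt => /predU1P[->|ij].
  by rewrite dfwith_in dfwith_out ?p1 // neq_ltn ltnSn orbT.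
by rewrite !dfwith_out ?p3 // gtn_eqF // ltnW.
Qed.

Lemma lift_last_square (X Y : cplx C) : bounded n.+1 Y -> cov_exact n Y ->
  forall s : square (last_arrow n X) (last_arrow n Y),
  exists f : cmap X Y, last_square n f = s.
Proof.
move=> bY eY s; have [p [p1 p2 p3]] := lift_down eY (leqnn n) (sqP s).
have pP i : p i.+1 ∘ cd X i = cd Y i ∘ p i.
  case: (leqP i n) => [/p3 //|ni].
  by rewrite (hom_to_zero (p i.+1 ∘ _)) ?(hom_to_zero (_ ∘ p i)) //; apply: bY.
by exists (Cmap pP); apply: square_ext.
Qed.

Lemma null_degree0 (X Y : cplx C) (f : cmap X Y) : cov_exact n Y ->
  f n = 0 -> exists h : hom (X 1%N) (Y 0%N), f 0%N = h ∘ cd X 0.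
Proof.
move=> [ex0 ex] fn.
suff gen j : (j <= n)%N ->
    (exists h : hom (X j.+1) (Y j), cd Y j ∘ (f j - h ∘ cd X j) = 0) ->
    exists h : hom (X 1%N) (Y 0%N), f 0%N = h ∘ cd X 0.
  by apply: (gen n) => //; exists 0; rewrite fn comp0f subrr compf0.
elim: j => [|j IH] jn [h e].
  by exists h; apply/eqP; rewrite -subr_eq0; apply/eqP/ex0.
have [h' e'] := ex _ jn _ _ e.
apply: IH (ltnW jn) _; exists h'.
rewrite compBr -cmP (compA _ h') -e' compBl -!compA cdd compf0 subr0.
by rewrite subrr.
Qed.

Section LiftKernels.
Variables (f g : arrowCat C) (X : nker f) (Y : nker g).
Implicit Types s : @phom (arrowCat C) f g.

Definition extends s (p : cmap X Y) : Prop :=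
  iso_hom (nk_last Y) ∙ last_square n p = s ∙ iso_hom (nk_last X)
    :> @phom (arrowCat C) (last_arrow n X) g.

Lemma extendsP s : exists p, extends s p.
Proof.
have [p e] := lift_last_square (nk_bounded Y) (nk_exact Y)
  (iso_inv (nk_last Y) ∙ (s ∙ iso_hom (nk_last X))).
by exists p; rewrite /extends e pcompA iso_invK pcomp1f.
Qed.

Definition extension s : cmap X Y := sval (cid (extendsP s)).

Lemma extensionP s : extends s (extension s).
Proof. exact: svalP (cid (extendsP s)). Qed.

Lemma extends_uniq s p q : extends s p -> extends s q ->
  coker_map p = coker_map q.
Proof.
rewrite /extends => ep eq; apply: eq_coker_map.
have e : last_square n p = last_square n q.
  rewrite -[LHS](@pcomp1f (arrowCat C)) -[RHS](@pcomp1f (arrowCat C)).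
  by rewrite -(iso_homK (nk_last Y)) -!pcompA ep eq.
have [|h eh] := @null_degree0 X Y (cmap_add p (cmap_opp q)) (nk_exact Y).
  by move: (congr1 (@sq1 _ _ _) e) => /= ->; rewrite subrr.
by exists h.
Qed.

End LiftKernels.

Lemma extends1 (f : arrowCat C) (X : nker f) : extends (pid f) (cmap1 X).
Proof.
rewrite /extends pcomp1f -[RHS](@pcompf1 (arrowCat C)); congr (_ ∙ _).
exact: square_ext.
Qed.

Lemma extends_comp (f g h : arrowCat C) (X : nker f) (Y : nker g) (Z : nker h)
    (t : phom g h) (s : phom f g) (q : cmap Y Z) (p : cmap X Y) :
  extends t q -> extends s p -> extends (t ∙ s) (cmap_comp q p).
Proof.
rewrite /extends => eq ep; rewrite -pcompA -ep pcompA -eq -pcompA.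
by congr (_ ∙ _); apply: square_ext.
Qed.

Lemma extends_add (f g : arrowCat C) (X : nker f) (Y : nker g)
    (s t : phom f g) (p q : cmap X Y) :
  extends s p -> extends t q -> extends (padd s t) (cmap_add p q).
Proof.
rewrite /extends => ep eq; rewrite pcompDl -ep -eq -pcompDr.
by congr (_ ∙ _); apply: square_ext.
Qed.

(** The cokernel functor does not depend on the choice of an n-kernel. *)
Lemma coker_nker_iso (f : arrowCat C) (X Y : nker f) :
  @isomorphic (funCat C) (coker (cd X 0)) (coker (cd Y 0)).
Proof.
have ext1 (U V : nker f) : coker_map (cmap_comp (extension V U (pid f))
    (extension U V (pid f))) = nat1 (coker (cd U 0)).
  rewrite -coker_map1; apply: extends_uniq (extends1 U).
  by rewrite -[pid f](pcomp1f (pid f)); apply: extends_comp;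
    rewrite pcomp1f; apply: extensionP.
constructor; apply: (@Iso (funCat C) _ _
  (coker_map (extension Y X (pid f))) (coker_map (extension X Y (pid f)))).
  exact: etrans (esym (coker_mapM _ _)) (ext1 X Y).
exact: etrans (esym (coker_mapM _ _)) (ext1 Y X).
Qed.

Definition nker_of_exact (X : cplx C) (hX : n_exact n X) :
    nker (last_arrow n X) :=
  @Nker (last_arrow n X) X (let: And3 b _ _ := hX in b)
    (let: And3 _ e _ := hX in e) (idIso (last_arrow n X : arrowCat C)).

End Lifting.

(** * The functors sigma'_F, Psi'_F and Phi'_F *)

Section Phi.
Variables (n : nat) (C : addCat) (F : addSubfunctor n C).

Definition F_epi (f : arrow C) : Prop :=
  exists X : cplx C, F_exact F X /\ f = last_arrow n X.

Definition epiCat : preaddCat := @fullSub (arrowCat C) F_epi.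

Definition in_modF (G : fpCat C) : Prop :=
  exists X : cplx C,
    F_exact F X /\ @isomorphic (funCat C) (sval G) (coker (cd X 0)).

Definition modF : preaddCat := @fullSub (fpCat C) in_modF.

Definition sigma' : functor (exactCat F) epiCat.
Proof.
refine (@Functor (exactCat F) epiCat
  (fun X => exist _ (last_arrow n (sval X))
     (ex_intro _ (sval X) (conj (svalP X) erefl)))
  (fun X Y f => @last_square C n (sval X) (sval Y) f) _ _ _).
- by move=> X; apply: square_ext.
- by move=> X Y Z g f; apply: square_ext.
- by move=> X Y f g; apply: square_ext.
Defined.

(** A choice of an n-kernel for each F-epimorphism. *)
Definition nker_choice := forall f : epiCat, nker n (sval f).

Lemma nker_choice_inhabited : inhabited nker_choice.
Proof.
have ex (f : epiCat) : exists k : nker n (sval f), True.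
  have [X [[hX _] ->]] := svalP f.
  by exists (nker_of_exact hX).
by constructor=> f; exact: sval (cid (ex f)).
Qed.

Variable K : nker_choice.

Definition Psi'_fp (f : epiCat) : fpCat C :=
  exist _ (coker (cd (K f) 0) : funCat C)
    (ex_intro _ _ (ex_intro _ _ (ex_intro _ (cd (K f) 0)
      (inhabits (idIso (coker (cd (K f) 0) : funCat C)))))).

Lemma Psi'_in_modF (f : epiCat) : in_modF (Psi'_fp f).
Proof.
have [X [FX ef]] := svalP f; have [hX _] := FX; exists X; split=> //=.
suff gen (u : arrow C) (Y : nker n u) : u = last_arrow n X ->
    @isomorphic (funCat C) (coker (cd Y 0)) (coker (cd X 0)).
  exact: gen.
move=> eu; move: Y; rewrite eu => Y.
exact: (@coker_nker_iso n C (last_arrow n X) Y (nker_of_exact hX)).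
Qed.

(** The image of a square is the map on the cokernels induced by an extension
    of the square to the chosen n-kernels; see [extends_uniq]. *)
Definition Psi' : functor (opCat epiCat) modF.
Proof.
refine (@Functor (opCat epiCat) modF
  (fun f => exist _ (Psi'_fp f) (Psi'_in_modF f))
  (fun f g s => coker_map (extension (K g) (K f) s)) _ _ _).
- move=> f; rewrite /= -coker_map1.
  exact: extends_uniq (extensionP _ _ _) (extends1 _).
- move=> f g h t s; rewrite /= -coker_mapM.
  apply: extends_uniq (extensionP _ _ _) _.
  by apply: extends_comp; apply: extensionP.
- move=> f g s t; rewrite /= -coker_mapD.
  apply: extends_uniq (extensionP _ _ _) _.
  by apply: extends_add; apply: extensionP.
Defined.

Definition Phi' : functor (opCat (exactCat F)) modF :=
  compFun Psi' (opFun sigma').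

End Phi.


(** * Artin algebras and finitely generated right modules *)

Definition is_ideal (k : comPzRingType) (J : k -> Prop) : Prop :=
  [/\ J 0, forall x y, J x -> J y -> J (x + y) & forall a x, J x -> J (a * x)].

Definition artinian (k : comPzRingType) : Prop :=
  forall J : nat -> k -> Prop, (forall i, is_ideal (J i)) ->
    (forall i x, J i.+1 x -> J i x) ->
    exists m, forall i x, (m <= i)%N -> J m x -> J i x.

(** [L] is an algebra, via [eta], over a commutative artinian ring [k], and is
    finitely generated as a [k]-module. The class [algType] is not used because
    it excludes the zero ring. *)
Definition artin_algebra (L : pzRingType) : Prop :=
  exists (k : comPzRingType) (eta : {rmorphism k -> L}),
    [/\ artinian k, forall a x, eta a * x = x * eta a &
      exists (m : nat) (e : 'I_m -> L),
        forall x, exists a : 'I_m -> k, x = \sum_(i < m) eta (a i) * e i].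

Definition fin_gen (R : pzRingType) (V : lmodType R) : Prop :=
  exists (m : nat) (e : 'I_m -> V),
    forall x, exists a : 'I_m -> R, x = \sum_(i < m) a i *: e i.

(** Right [L]-modules are left modules over the converse ring [L^c]. *)
Record fgMod (L : pzRingType) := FgMod {
  fg_mod :> lmodType L^c;
  fg_modP : fin_gen fg_mod
}.

Section LinearMaps.
Variable R : pzRingType.
Implicit Types U V W : lmodType R.

Definition linHom U V : Type := {linear U -> V}.

Definition lin_fun U V (f : linHom U V) : U -> V :=
  GRing.Linear.sort (f : {linear U -> V}).
Coercion lin_fun : linHom >-> Funclass.

Lemma linHom_ext U V (f g : linHom U V) : f =1 g -> f = g.
Proof.
case: f g => f cf [g cg] e; have {}e : f = g by apply/funext.
move: cf cg; rewrite e => -[[a] [b]] [[c] [d]].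
by rewrite (Prop_irrelevance a c) (Prop_irrelevance b d).
Qed.

Section MkLin.
Variables (U V : lmodType R) (f : U -> V) (f_lin : linear f).
Let g of linear f := f.
HB.instance Definition _ := GRing.isLinear.Build R U V *:%R (g f_lin) f_lin.
Definition mk_lin : linHom U V := (g f_lin : {linear U -> V}).
End MkLin.

Definition lin_id U : linHom U U := (idfun : {linear U -> U}).
Definition lin_comp U V W (g : linHom V W) (f : linHom U V) : linHom U W :=
  ((g : {linear V -> W}) \o (f : {linear U -> V}) : {linear U -> W}).
Definition lin_zero U V : linHom U V := (\0 : {linear U -> V}).
Definition lin_add U V (f g : linHom U V) : linHom U V :=
  ((f : {linear U -> V}) \+ (g : {linear U -> V}) : {linear U -> V}).
Definition lin_opp U V (f : linHom U V) : linHom U V :=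
  (\- (f : {linear U -> V}) : {linear U -> V}).

Section LinZmod.
Variables U V : lmodType R.

Lemma lin_addA : associative (@lin_add U V).
Proof. by move=> f g h; apply: linHom_ext => x; apply: addrA. Qed.
Lemma lin_addC : commutative (@lin_add U V).
Proof. by move=> f g; apply: linHom_ext => x; apply: addrC. Qed.
Lemma lin_add0 : left_id (lin_zero U V) (@lin_add U V).
Proof. by move=> f; apply: linHom_ext => x; apply: add0r. Qed.
Lemma lin_addN : left_inverse (lin_zero U V) (@lin_opp U V) (@lin_add U V).
Proof. by move=> f; apply: linHom_ext => x; apply: addNr. Qed.

HB.instance Definition _ := gen_eqMixin (linHom U V).
HB.instance Definition _ := gen_choiceMixin (linHom U V).
HB.instance Definition _ :=
  GRing.isZmodule.Build (linHom U V) lin_addA lin_addC lin_add0 lin_addN.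
End LinZmod.

Lemma lin_addE U V (f g : linHom U V) x : (f + g) x = f x + g x.
Proof. by []. Qed.
Lemma lin_zeroE U V x : (0 : linHom U V) x = 0.
Proof. by []. Qed.

End LinearMaps.

Section RightModules.
Variable L : pzRingType.
Implicit Types U V : fgMod L.

Lemma zero_mod_fin_gen : fin_gen ('rV[L^c]_0 : lmodType L^c).
Proof.
exists 0%N, (fun=> 0) => x; exists (fun=> 0); rewrite big_ord0.
by apply/rowP => -[].
Qed.
Definition zero_mod : fgMod L := FgMod zero_mod_fin_gen.

Lemma sum_mod_fin_gen U V : fin_gen ((U * V)%type : lmodType L^c).
Proof.
have [m [e eP]] := fg_modP U; have [p [d dP]] := fg_modP V.
exists (m + p)%N, (fun i => match split i with
  | inl j => (e j, 0) | inr j => (0, d j) end) => -[u v].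
have [a ->] := eP u; have [b ->] := dP v.
exists (fun i => match split i with inl j => a j | inr j => b j end).
rewrite big_split_ord /=.
rewrite (eq_bigr (fun i => (a i *: e i, 0))); last first.
  by move=> i _; rewrite (unsplitK (inl i)); congr pair; rewrite /= scaler0.
rewrite [X in _ = _ + X](eq_bigr (fun i => (0, b i *: d i))); last first.
  by move=> i _; rewrite (unsplitK (inr i)); congr pair; rewrite /= scaler0.
have pairsum (I : finType) (x : I -> U) (y : I -> V) :
    \sum_i (x i, y i) = (\sum_i x i, \sum_i y i).
  by elim/big_ind3: _ => // ? ? ? ? ? ? -> ->.
by rewrite !pairsum !big1_eq; congr pair; rewrite ?addr0 ?add0r.
Qed.
Definition sum_mod U V : fgMod L := FgMod (sum_mod_fin_gen U V).

Lemma mod_in1P U V : linear (fun u : U => (u, 0) : sum_mod U V).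
Proof. by move=> a x y; congr pair; rewrite /= scaler0 addr0. Qed.
Lemma mod_in2P U V : linear (fun v : V => (0, v) : sum_mod U V).
Proof. by move=> a x y; congr pair; rewrite /= scaler0 addr0. Qed.
Lemma mod_pr1P U V : linear (fun x : sum_mod U V => x.1).
Proof. by []. Qed.
Lemma mod_pr2P U V : linear (fun x : sum_mod U V => x.2).
Proof. by []. Qed.

(** mod-L *)
Definition modCat : addCat.
Proof.
refine (@AddCat (fgMod L) (fun U V => linHom U V) (fun U => lin_id U)
  (fun U V W g f => lin_comp g f) _ _ _ _ _ zero_mod _ sum_mod
  (fun U V => mk_lin (@mod_in1P U V)) (fun U V => mk_lin (@mod_in2P U V))
  (fun U V => mk_lin (@mod_pr1P U V)) (fun U V => mk_lin (@mod_pr2P U V))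
  _ _ _ _ _).
- by move=> *; apply: linHom_ext.
- by move=> *; apply: linHom_ext.
- by move=> *; apply: linHom_ext.
- by move=> *; apply: linHom_ext.
- by move=> U V W g f h; apply: linHom_ext => x; apply: (linearD (g : {linear _ -> _})).
- by apply: linHom_ext => x; apply/rowP => -[].
- by move=> *; apply: linHom_ext.
- by move=> *; apply: linHom_ext.
- by move=> *; apply: linHom_ext.
- by move=> *; apply: linHom_ext.
- move=> U V; apply: linHom_ext => -[u v].
  by congr pair; rewrite /= ?addr0 ?add0r.
Defined.

End RightModules.

(** ** Full additive subcategories *)

Section FullAddSub.
Variables (C : addCat) (P : C -> Prop).
Hypothesis P0 : P zob.
Hypothesis PD : forall X Y, P X -> P Y -> P (bip X Y).

Definition fullAddSub : addCat.
Proof.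
refine (@AddCat {X : C | P X} (fun X Y => hom (sval X) (sval Y))
  (fun X => idm (sval X)) (fun X Y Z g f => g ∘ f) _ _ _ _ _
  (exist _ zob P0) (@zobP C)
  (fun X Y => exist _ (bip (sval X) (sval Y)) (PD (svalP X) (svalP Y)))
  (fun X Y => in1) (fun X Y => in2) (fun X Y => pr1) (fun X Y => pr2)
  _ _ _ _ _).
- by move=> *; apply: compA.
- by move=> *; apply: comp1f.
- by move=> *; apply: compf1.
- by move=> *; apply: compDl.
- by move=> *; apply: compDr.
- by move=> *; apply: pr1in1.
- by move=> *; apply: pr2in2.
- by move=> *; apply: pr1in2.
- by move=> *; apply: pr2in1.
- by move=> *; apply: in_pr.
Defined.

End FullAddSub.

(** * n-cluster tilting subcategories of mod-L *)

Section ClusterTilting.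
Variable L : pzRingType.
Local Notation modL := (modCat L).
Implicit Types X Y : modL.

Definition mod_fun X Y (f : hom X Y) : fg_mod X -> fg_mod Y := lin_fun f.

Definition projective (Q : modL) : Prop :=
  forall X Y (g : hom X Y) (f : hom Q Y),
    (forall y, exists x, mod_fun g x = y) -> exists h : hom Q X, f = g ∘ h.

(** Projective resolutions ... -> P_1 -> P_0 -> X -> 0 in mod-L *)
Record proj_resolution X := ProjResolution {
  res :> nat -> modL;
  res_proj : forall i, projective (res i);
  res_d : forall i, hom (res i.+1) (res i);
  res_aug : hom (res 0%N) X;
  res_aug_surj : forall x, exists y, mod_fun res_aug y = x;
  res_exact0 : forall y,
    mod_fun res_aug y = 0 <-> exists z, y = mod_fun (res_d 0) z;
  res_exactS : forall i y,
    mod_fun (res_d i) y = 0 <-> exists z, y = mod_fun (res_d i.+1) z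
}.

Definition cocycle X Y (R : proj_resolution X) i (f : hom (R i) Y) : Prop :=
  f ∘ res_d R i = 0.

Definition coboundary X Y (R : proj_resolution X) i : hom (R i) Y -> Prop :=
  match i with
  | 0 => fun f => f = 0
  | j.+1 => fun f => exists g : hom (R j) Y, f = g ∘ res_d R j
  end.

(** Ext^i(X, Y) = 0, i.e. the i-th cohomology of Hom(R, Y) vanishes. *)
Definition Ext_vanishes i X Y : Prop :=
  forall (R : proj_resolution X) (f : hom (R i) Y),
    cocycle f -> coboundary f.

Definition contravariantly_finite (P : modL -> Prop) : Prop :=
  forall X, exists (M : modL) (f : hom M X), P M /\
    forall (M' : modL) (g : hom M' X), P M' -> exists h : hom M' M, g = f ∘ h.

Definition covariantly_finite (P : modL -> Prop) : Prop :=
  forall X, exists (M : modL) (f : hom X M), P M /\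
    forall (M' : modL) (g : hom X M'), P M' -> exists h : hom M M', g = h ∘ f.

Definition generating (P : modL -> Prop) : Prop :=
  forall X, exists (M : modL) (f : hom M X),
    P M /\ forall x, exists y, mod_fun f y = x.

Definition cogenerating (P : modL -> Prop) : Prop :=
  forall X, exists (M : modL) (f : hom X M), P M /\ injective (mod_fun f).

Record n_cluster_tilting (n : nat) (P : modL -> Prop) : Prop := NClusterTilting {
  ct_zero : P zob;
  ct_bip : forall X Y, P X -> P Y -> P (bip X Y);
  ct_contra : contravariantly_finite P;
  ct_cov : covariantly_finite P;
  ct_gen : generating P;
  ct_cogen : cogenerating P;
  ct_ext_from : forall X, P X <->
    forall M i, P M -> (0 < i < n)%N -> Ext_vanishes i M X;
  ct_ext_to : forall X, P X <->
    forall M i, P M -> (0 < i < n)%N -> Ext_vanishes i X M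
}.

(** An n-cluster tilting subcategory as an additive category. *)
Definition ctCat n (P : modL -> Prop) (HP : n_cluster_tilting n P) : addCat :=
  fullAddSub (ct_zero HP) (ct_bip HP).

End ClusterTilting.

(* Main.v *)
From mathcomp Require Import all_boot all_algebra.
From mathcomp Require Import boolp.
Require Import Defs.

(** The functor Phi' is isomorphic to the functor sending a complex X to
    Coker(C(X^1,-) -> C(X^0,-)). By Yoneda a map between such cokernels is
    induced by a square in degrees 0 and 1, and contravariant exactness extends
    this square step by step to the right: Phi' is full. If the induced map
    vanishes, then f^0 factors through X^0 -> X^1, and the same exactness
    extends this factorisation to a contraction of f. A null-homotopic map
    factors through the contractible complex built from the objects X^{i+1},
    which is F-exact and is killed by Phi'. Hence the kernel of Phi' is the
    ideal of null-homotopic maps. *)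

Set Implicit Arguments.
Unset Strict Implicit.
Unset Printing Implicit Defensive.

Import GRing.Theory.
Local Open Scope ring_scope.

(** * Transport of maps along isomorphisms *)

Section IsoSquares.
Variables (D : preaddCat) (A B A' B' : D) (i : iso A A') (j : iso B B').

Lemma iso_square_uniq (u : phom A B) (v w : phom A' B') :
  iso_hom j ∙ u = v ∙ iso_hom i -> iso_hom j ∙ u = w ∙ iso_hom i -> v = w.
Proof.
move=> ev ew; rewrite -[v]pcompf1 -[w]pcompf1 -(iso_invK i) !pcompA.
by rewrite -ev -ew.
Qed.

Lemma iso_square_ex (v : phom A' B') :
  exists u : phom A B, iso_hom j ∙ u = v ∙ iso_hom i.
Proof.
by exists (iso_inv j ∙ (v ∙ iso_hom i)); rewrite pcompA iso_invK pcomp1f.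
Qed.

Lemma iso_square_eq0 (u : phom A B) (v : phom A' B') :
  iso_hom j ∙ u = v ∙ iso_hom i -> u = pzero A B <-> v = pzero A' B'.
Proof.
move=> e; split=> z; rewrite z in e.
  by rewrite (iso_square_uniq e (w := pzero A' B')) // pcomp0f pcompf0.
by rewrite -[u]pcomp1f -(iso_homK j) -pcompA e pcomp0f pcompf0.
Qed.

End IsoSquares.

(** * Strict equality of functors and the criterion for equivalences *)

Section Equivalence.
Variables (C D : preaddCat) (F : functor C D).

(** Once the object maps are identified, the transports run along proofs of [X = X] and vanish by
    proof irrelevance. *)
Lemma functor_eq (G : functor C D)
    (e : forall X, F X = G X) :
  (forall X Y (f : phom X Y),
     eq_rect (F Y) (fun V => phom (G X) V)
       (eq_rect (F X) (fun U => phom U (F Y)) (fmor F f) _ (e X)) _ (e Y)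
     = fmor G f) -> F = G.
Proof.
case: F G e => [fo fm f1 fM fD] [go gm g1 gM gD] /= e.
have eo : fo = go by apply/funext.
move: gm g1 gM gD e; rewrite -{}eo => gm g1 gM gD e em.
have {}em : fm = gm.
  apply: functional_extensionality_dep => X.
  apply: functional_extensionality_dep => Y; apply/funext => f.
  have := em X Y f.
  by rewrite (Prop_irrelevance (e X) erefl) (Prop_irrelevance (e Y) erefl).
move: g1 gM gD; rewrite -{}em => g1 gM gD.
by congr Functor; apply: Prop_irrelevance.
Qed.

Definition faithful :=
  forall (X Y : C) (f g : phom X Y), fmor F f = fmor F g -> f = g.

(** Chosen preimages of objects and lifts of maps define the quasi-inverse; faithfulness gives its
    functor laws. Lifting [eps (F X)] and its inverse gives the isomorphism between [G (F X)] and
    [X]. *)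
Lemma equivalence_of_full_faithful_dense :
  full F -> faithful -> dense F -> is_equivalence F.
Proof.
move=> Ffull Ffaith Fdense.
have ex (Y : D) : exists X : C, inhabited (iso (F X) Y) by exact: Fdense.
pose go Y := sval (cid (ex Y)).
have exi Y : exists i : iso (F (go Y)) Y, True.
  by have [i] := svalP (cid (ex Y)); exists i.
pose eps Y : iso (F (go Y)) Y := sval (cid (exi Y)).
pose lift X Y (f : phom (F X) (F Y)) : phom X Y := sval (cid (Ffull X Y f)).
have liftK X Y (f : phom (F X) (F Y)) : fmor F (lift X Y f) = f.
  exact: svalP (cid (Ffull X Y f)).
pose gm Y Z (f : phom Y Z) : phom (go Y) (go Z) :=
  lift _ _ (iso_inv (eps Z) ∙ (f ∙ iso_hom (eps Y))).
have gmK Y Z (f : phom Y Z) :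
    fmor F (gm Y Z f) = iso_inv (eps Z) ∙ (f ∙ iso_hom (eps Y)).
  exact: liftK.
clearbody eps lift gm.
have g1 Y : gm Y Y (pid Y) = pid (go Y).
  by apply: Ffaith; rewrite gmK pcomp1f iso_homK fmor1.
have gM X Y Z (g : phom Y Z) (f : phom X Y) :
    gm X Z (g ∙ f) = gm Y Z g ∙ gm X Y f.
  apply: Ffaith; rewrite fmorM !gmK -!pcompA.
  by rewrite (pcompA (iso_hom (eps Y))) iso_invK pcomp1f.
have gD X Y (f g : phom X Y) : gm X Y (padd f g) = padd (gm X Y f) (gm X Y g).
  by apply: Ffaith; rewrite fmorD !gmK pcompDl pcompDr.
pose G := Functor g1 gM gD.
exists G; split.
- constructor.
  have k1 (X : C) :
      lift _ _ (iso_inv (eps (F X))) ∙ lift _ _ (iso_hom (eps (F X))) = pid (go (F X)).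
    by apply: Ffaith; rewrite fmorM !liftK iso_homK fmor1.
  have k2 (X : C) :
      lift _ _ (iso_hom (eps (F X))) ∙ lift _ _ (iso_inv (eps (F X))) = pid X.
    by apply: Ffaith; rewrite fmorM !liftK iso_invK fmor1.
  refine (@NatIso _ _ (compFun G F) (idFun C)
    (fun X => @Iso C (go (F X)) X _ _ (k1 X) (k2 X)) _) => X Y f /=.
  apply: Ffaith; rewrite !fmorM !liftK gmK.
  by rewrite pcompA iso_invK pcomp1f.
- constructor.
  refine (@NatIso _ _ (compFun F G) (idFun D) eps _) => X Y f /=.
  by rewrite gmK pcompA iso_invK pcomp1f.
Qed.

End Equivalence.

(** * Descent of a functor to the quotient by its kernel *)

Section QuotientFunctor.
Variables (C D : preaddCat) (I : ideal C) (F : functor (opCat C) D).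
Hypothesis F_kernel : forall (X Y : C) (f : @phom C X Y),
  @fmor (opCat C) D F Y X f = pzero (F Y) (F X) <-> in_ideal I f.

Lemma fmor_eq_ideal (X Y : C) (f g : @phom C X Y) :
  @fmor (opCat C) D F Y X f = @fmor (opCat C) D F Y X g <->
  in_ideal I (padd f (popp g)).
Proof.
rewrite -F_kernel.
have fE : f = padd (padd f (popp g)) g by rewrite -paddA paddNf paddf0.
have := etrans (congr1 (@fmor (opCat C) D F Y X) fE) (fmorD F _ _).
move=> ->; split=> [e|->]; last exact: padd0f.
by apply: (@paddI _ _ _ (fmor F g)); rewrite paddC e paddf0.
Qed.

(** By [fmor_eq_ideal] the value does not depend on the representative [qrepr c]. *)
Definition quot_desc : functor (opCat (quotCat I)) D.
Proof.
refine (@Functor (opCat (quotCat I)) D F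
  (fun X Y c => @fmor (opCat C) D F X Y (qrepr c)) _ _ _).
- move=> X; rewrite -[RHS]fmor1; exact/fmor_eq_ideal/qrepr_pi.
- move=> X Y Z g f; rewrite -fmorM; apply/fmor_eq_ideal; exact: qrepr_pi.
- move=> X Y f g; rewrite -fmorD; apply/fmor_eq_ideal; exact: qrepr_pi.
Defined.

Lemma quot_descE : compFun quot_desc (opFun (quotFun I)) = F.
Proof.
apply: (@functor_eq _ _ (compFun quot_desc (opFun (quotFun I))) F
  (fun=> erefl)) => X Y f /=.
exact/fmor_eq_ideal/qrepr_pi.
Qed.

Lemma quot_desc_duality : full F -> dense F -> is_duality quot_desc.
Proof.
move=> Ffull Fdense; apply: equivalence_of_full_faithful_dense => //.
- move=> X Y g; have [f <-] := Ffull X Y g.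
  exists (qpi I f : @phom (opCat (quotCat I)) X Y).
  exact/fmor_eq_ideal/qrepr_pi.
- move=> X Y f g /= /fmor_eq_ideal e.
  by rewrite -[f]qreprK -[g]qreprK; exact: eq_qpi.
Qed.

End QuotientFunctor.

(** * Contractions, extension of maps, and cokernel functors *)

Section Complexes.
Variable C : addCat.

Section ContractibleComplex.
Variable Z : nat -> C.

Definition disk_ob i : C := if i is j.+1 then bip (Z i) (Z j) else Z 0%N.

(** Degree 0 has the single summand [Z 0]; this projection and [disk_in1] hide the case split, so
    that [disk_d] and [disk_s] have one formula in all degrees. *)
Definition disk_fst i : hom (disk_ob i) (Z i) :=
  if i is j.+1 then pr1 else idm _.

Definition disk_in1 i : hom (Z i) (disk_ob i) :=
  if i is j.+1 then in1 else idm _.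

Lemma disk_fst_in1 i : disk_fst i ∘ disk_in1 i = idm (Z i).
Proof. by case: i => [|i] /=; rewrite ?comp1f ?pr1in1. Qed.

Definition disk_d i : hom (disk_ob i) (disk_ob i.+1) := in2 ∘ disk_fst i.

Definition disk_s i : hom (disk_ob i.+1) (disk_ob i) := disk_in1 i ∘ pr2.

Lemma disk_dd i : disk_d i.+1 ∘ disk_d i = 0.
Proof.
by rewrite /disk_d compA -(compA in2 pr1 in2) pr1in2 compf0 comp0f.
Qed.

(** The direct sum of the complexes [Z i -> Z i] in degrees [i] and [i + 1]. *)
Definition disks : cplx C := Cplx disk_dd.

Lemma disks_contractible : null_homotopic (cmap1 disks).
Proof.
exists disk_s; split=> [|i] /=; rewrite /disk_s /disk_d /=.
  by rewrite compA -(compA (idm _)) pr2in2 !compf1.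
rewrite !compA -(compA in1 pr2) pr2in2 compf1.
by rewrite -(compA in2 (disk_fst i)) disk_fst_in1 compf1 addrC in_pr.
Qed.

End ContractibleComplex.

(** Composing [g] with the identity [1 = d s + s d] exhibits the required factorisation through [d],
    on either side. *)
Lemma contractible_n_exact n (X : cplx C) :
  bounded n.+1 X -> null_homotopic (cmap1 X) -> n_exact n X.
Proof.
move=> bX [s [s0 sS]].
have id0 : idm _ = s 0%N ∘ cd X 0 by exact: s0.
have idS i : idm _ = cd X i ∘ s i + s i.+1 ∘ cd X i.+1 by exact: sS.
split=> //; split.
- by move=> Z g e; rewrite -[g]comp1f id0 -compA e compf0.
- move=> i _ Z g e; exists (s i ∘ g).
  by rewrite -[LHS]comp1f idS compDl -!compA e compf0 addr0.
- move=> Z g e; rewrite -[g]compf1 idS compDr !compA e comp0f add0r.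
  (* The term [s d] in degree [n + 1] passes through [X n.+2], which is zero. *)
  by rewrite (hom_to_zero (cd X n.+1)) ?compf0 //; apply: bX.
- move=> i _ Z g e; exists (g ∘ s i.+1).
  by rewrite -[LHS]compf1 idS compDr !compA e comp0f add0r.
Qed.

(** In positive degrees [g] is [x |-> (d x, x)] and [h] is [(x, y) |-> s x + d (s y)], so the
    composite is [s d + d s]; in degree 0 they reduce to [d] and [s]. *)
Lemma null_homotopic_factor (X Y : cplx C) (f : cmap X Y) :
  null_homotopic f ->
  exists (g : cmap X (disks (fun i => X i.+1)))
         (h : cmap (disks (fun i => X i.+1)) Y), f = cmap_comp h g.
Proof.
move=> [s [s0 sS]].
pose Z i := X i.+1.
pose g i : hom (X i) (disks Z i) :=
  if i is j.+1 then in1 ∘ cd X j.+1 + in2 else cd X 0.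
have fstg i : disk_fst Z i ∘ g i = cd X i.
  case: i => [|i] /=; first by rewrite comp1f.
  by rewrite compDr compA pr1in1 pr1in2 addr0 comp1f.
have gP i : g i.+1 ∘ cd X i = cd (disks Z) i ∘ g i.
  by rewrite /= /disk_d -compA fstg compDl -compA cdd compf0 add0r.
pose h i : hom (disks Z i) (Y i) :=
  if i is j.+1 return hom (disks Z i) (Y i)
  then s j.+1 ∘ pr1 + cd Y j ∘ s j ∘ pr2 else s 0%N.
have hP i : h i.+1 ∘ cd (disks Z) i = cd Y i ∘ h i.
  rewrite /= /disk_d compDl compA -(compA _ pr1) pr1in2 compf0 comp0f add0r.
  rewrite compA -(compA _ pr2) pr2in2 compf1 -compA.
  case: i => [|i] /=; first by rewrite compf1.
  by rewrite compDr !compA cdd !comp0f addr0.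
exists (Cmap gP), (Cmap hP); apply: cmap_ext => -[|i] /=.
  by rewrite s0.
rewrite sS compDl !compDr -!compA !(compA pr1) !(compA pr2).
rewrite pr1in1 pr2in1 pr1in2 pr2in2 comp1f comp0f !compf0 compf1.
by rewrite addr0 add0r addrC.
Qed.

(** The recursion runs over related pairs, since choosing a term requires the relation between the
    two preceding ones. *)
Lemma dependent_choice_seq (T : nat -> Type) (R : forall i, T i -> T i.+1 -> Prop)
    (x0 : T 0%N) (x1 : T 1%N) :
  R 0%N x0 x1 ->
  (forall i x y, R i x y -> exists z, R i.+1 y z) ->
  exists p : forall i, T i, p 0%N = x0 /\ forall i, R i (p i) (p i.+1).
Proof.
move=> R0 step.
pose S i := {xy : T i * T i.+1 | R i xy.1 xy.2}.
pose next i (u : S i) : S i.+1 :=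
  let w := cid (step i _ _ (svalP u)) in
  exist _ ((sval u).2, sval w) (svalP w).
pose u := fix u i : S i := if i is j.+1 then next j (u j) else
  exist _ (x0, x1) R0.
by exists (fun i => (sval (u i)).1); split=> // i; apply: (svalP (u i)).
Qed.

(** If [y] is the component in degree [i + 1], then [d y] kills [cd X i], hence factors through
    [cd X i.+1]; the factor is the next component. *)
Lemma extend_right n (X Y : cplx C) :
  con_exact n X -> bounded n.+1 Y ->
  forall (a : hom (X 0%N) (Y 0%N)) (b : hom (X 1%N) (Y 1%N)),
  b ∘ cd X 0 = cd Y 0 ∘ a -> exists f : cmap X Y, f 0%N = a.
Proof.
move=> [_ ex] bY a b ab.
have [i x y e|p [p0 pP]] := @dependent_choice_seq (fun i => hom (X i) (Y i))
  (fun i x y => y ∘ cd X i = cd Y i ∘ x) a b ab.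
- have [ni|ni] := ltnP i n.
    have [|h eh] := ex i ni _ (cd Y i.+1 ∘ y); last by exists h.
    by rewrite -compA e compA cdd comp0f.
  (* From [i = n] on, the target [Y i.+2] is zero. *)
  exists 0; rewrite comp0f [RHS]hom_to_zero //; apply: bY; exact: ni.
by exists (Cmap pP).
Qed.

(** The error [f - d h] kills the incoming differential, so it factors through the outgoing one; the
    factor is the next homotopy component ([step]), and the resulting identity makes the next error
    kill its differential ([kill]). *)
Lemma null_homotopic_degree0 n (X Y : cplx C) (f : cmap X Y) :
  con_exact n X -> bounded n.+1 Y ->
  (exists h : hom (X 1%N) (Y 0%N), f 0%N = h ∘ cd X 0) ->
  null_homotopic f.
Proof.
move=> [ex0 ex] bY [h0 e0].
have step i (h : hom (X i.+1) (Y i)) :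
    (f i.+1 - cd Y i ∘ h) ∘ cd X i = 0 -> exists k : hom (X i.+2) (Y i.+1),
    f i.+1 = cd Y i ∘ h + k ∘ cd X i.+1.
  move=> e; have [ni|] := ltnP i n.
    by have [k ek] := ex i ni _ _ e; exists k; rewrite -ek addrC subrK.
  rewrite leq_eqVlt => /predU1P[en|ni].
    (* In degree [n + 1] the error itself is zero, because [cd X n] is an epimorphism. *)
    subst i; exists 0; rewrite comp0f addr0; apply/eqP.
    by rewrite -subr_eq0; apply/eqP/ex0.
  exists 0; rewrite comp0f addr0 (hom_to_zero (f i.+1)) ?[RHS]hom_to_zero //;
    exact: bY.
have kill i (h : hom (X i.+1) (Y i)) (k : hom (X i.+2) (Y i.+1)) :
    f i.+1 = cd Y i ∘ h + k ∘ cd X i.+1 ->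
    (f i.+2 - cd Y i.+1 ∘ k) ∘ cd X i.+1 = 0.
  by move=> e; rewrite compBl cmP e compDr !compA cdd comp0f add0r subrr.
have [|k0 ek0] := step 0%N h0.
  by rewrite compBl cmP e0 compA subrr.
have [i h k /kill/step//|h [eh hP]] := @dependent_choice_seq
  (fun i => hom (X i.+1) (Y i))
  (fun i h k => f i.+1 = cd Y i ∘ h + k ∘ cd X i.+1) h0 k0 ek0.
by exists h; rewrite eh.
Qed.

Lemma coker_pi0 (X Y : C) (f : hom X Y) Z :
  coker_pi f (0 : hom X Z) = 0.
Proof. by apply: (addrI (coker_pi f 0)); rewrite -coker_piD !addr0. Qed.

(** Yoneda: the map is tested on the class of the identity of [Y 0], whose image is the class of
    [f 0]. *)
Lemma coker_map0 (X Y : cplx C) (f : cmap X Y) :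
  coker_map f = nat0 _ _ <->
  exists h : hom (X 1%N) (Y 0%N), f 0%N = h ∘ cd X 0.
Proof.
split=> [e|[h e]].
  have := congr1 (fun t : natTrans (coker (cd Y 0)) (coker (cd X 0)) =>
    t (Y 0%N) (coker_pi (cd Y 0) (idm _))) e.
  rewrite /= coker_map_pi comp1f => e'.
  have /coker_piP[h] : coker_pi (cd X 0) (f 0%N) = coker_pi (cd X 0) 0.
    by rewrite coker_pi0.
  by rewrite subr0; exists h.
apply: natTrans_ext => Z x; rewrite -[x]coker_reprK /= coker_map_pi.
rewrite -(coker_pi0 (cd X 0) Z).
apply/coker_piP; exists (coker_repr x ∘ h).
by rewrite subr0 e compA.
Qed.

Lemma coker_map_eq0 n (X Y : cplx C) (f : cmap X Y) :
  con_exact n X -> bounded n.+1 Y ->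
  coker_map f = nat0 _ _ <-> null_homotopic f.
Proof.
move=> eX bY; split=> [/coker_map0|[h [h0 _]]].
  exact: null_homotopic_degree0 eX bY.
by apply/coker_map0; exists (h 0%N).
Qed.

Lemma coker_map_full n (X Y : cplx C) : con_exact n X -> bounded n.+1 Y ->
  forall t : natTrans (coker (cd Y 0)) (coker (cd X 0)),
  exists f : cmap X Y, coker_map f = t.
Proof.
move=> eX bY t.
pose a := coker_repr (t (Y 0%N) (coker_pi (cd Y 0) (idm _))).
have tE Z (g : hom (Y 0%N) Z) :
    t Z (coker_pi (cd Y 0) g) = coker_pi (cd X 0) (g ∘ a).
  rewrite -[in LHS](compf1 g) -(coker_mor_pi (cd Y 0) g).
  by rewrite (ntP t g) /= -[t _ _]coker_reprK coker_mor_pi.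
(* The class of [cd Y 0] is zero, hence so is its image under [t]; this provides the component [b]
   in degree 1 that starts the extension. *)
have : coker_pi (cd X 0) (cd Y 0 ∘ a) = coker_pi (cd X 0) 0.
  rewrite -tE -(comp0f _ a) -tE; congr (t _ _).
  by apply/coker_piP; exists (idm _); rewrite subr0 comp1f.
move/coker_piP=> [b]; rewrite subr0 => e.
have [f ef] := extend_right eX bY (esym e).
exists f; apply: natTrans_ext => Z x; rewrite -[x]coker_reprK.
by rewrite tE -ef [LHS]coker_map_pi.
Qed.

End Complexes.

(** * Kernel, fullness, density and objectivity of [Phi'] *)

Section PhiProperties.
Variables (n : nat) (C : addCat) (F : addSubfunctor n C) (K : nker_choice F).
Implicit Types X Y : exactCat F.

Lemma F_n_exact X : n_exact n (sval X).
Proof. by have [] := svalP X. Qed.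

Definition self_nker X := nker_of_exact (F_n_exact X).

(** [Phi'] forgets all but the last map of [X] and takes the chosen n-kernel. Lifts of the identity
    square compare it with [X]; they become mutually inverse on cokernels. *)
Definition to_choice X := extension (self_nker X) (K (sigma' F X)) (pid _).
Definition of_choice X := extension (K (sigma' F X)) (self_nker X) (pid _).

Lemma coker_extension_inv (f : arrowCat C) (U V : nker n f) :
  nat_comp (coker_map (extension U V (pid f)))
    (coker_map (extension V U (pid f))) = nat1 (coker (cd U 0)).
Proof.
rewrite -coker_mapM -coker_map1; apply: extends_uniq (extends1 U).
by rewrite -[pid f](pcomp1f (pid f)); apply: extends_comp;
  rewrite pcomp1f; apply: extensionP.
Qed.

Definition coker_choice_iso X : @iso (funCat C)
    (coker (cd (sval X) 0)) (coker (cd (K (sigma' F X)) 0)) :=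
  @Iso (funCat C) (coker (cd (sval X) 0)) (coker (cd (K (sigma' F X)) 0))
    (coker_map (of_choice X)) (coker_map (to_choice X))
    (coker_extension_inv (self_nker X) (K (sigma' F X)))
    (coker_extension_inv (K (sigma' F X)) (self_nker X)).

Lemma sigma'_extends X Y (f : phom X Y) :
  @extends n C (last_arrow n (sval X)) (last_arrow n (sval Y)) (self_nker X)
    (self_nker Y) (fmor (sigma' F) f) f.
Proof. by rewrite /extends pcomp1f pcompf1. Qed.

(** The value of [Phi'] at [f], seen in [funCat] and free of the full-subcategory wrappers. *)
Definition Phi'_nat X Y (f : phom X Y) :
    natTrans (coker (cd (K (sigma' F Y)) 0)) (coker (cd (K (sigma' F X)) 0)) :=
  coker_map (extension (K (sigma' F X)) (K (sigma' F Y)) (fmor (sigma' F) f)).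

(** Both composites are induced by lifts of the same square, so [extends_uniq] applies. *)
Lemma coker_choice_nat X Y (f : phom X Y) :
  nat_comp (coker_map (of_choice X)) (coker_map (f : cmap (sval X) (sval Y))) =
  nat_comp (Phi'_nat f) (coker_map (of_choice Y)).
Proof.
rewrite -!coker_mapM; pose s := fmor (sigma' F) f.
apply: (@extends_uniq n C _ _ _ (self_nker Y) s).
- rewrite -[s](@pcompf1 (arrowCat C)).
  exact: (extends_comp (sigma'_extends f) (extensionP _ _ _)).
- rewrite -[s](@pcomp1f (arrowCat C)).
  exact: (extends_comp (extensionP _ _ _) (extensionP _ _ _)).
Qed.

Lemma Phi'_nat0 X Y (f : phom X Y) :
  Phi'_nat f = nat0 _ _ <->
  coker_map (f : cmap (sval X) (sval Y)) = nat0 _ _.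
Proof.
apply: iff_sym.
exact: (@iso_square_eq0 (funCat C) _ _ _ _ (coker_choice_iso Y)
  (coker_choice_iso X) _ _ (coker_choice_nat f)).
Qed.

Lemma Phi'_nat_eq0 X Y (f : phom X Y) :
  Phi'_nat f = nat0 _ _ <-> null_homotopic (f : cmap (sval X) (sval Y)).
Proof.
have [_ _ eX] := F_n_exact X; have [bY _ _] := F_n_exact Y.
apply: iff_trans (Phi'_nat0 f) _.
exact: coker_map_eq0 eX bY.
Qed.

Lemma Phi'_eq0E X Y (f : phom X Y) :
  (@fmor (opCat (exactCat F)) (modF F) (Phi' K) Y X f = pzero _ _)
  = (Phi'_nat f = nat0 _ _).
Proof. exact: erefl. Qed.

Lemma in_null_homotopic_ideal X Y (f : phom X Y) :
  in_ideal (null_homotopic_ideal F) f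
  = null_homotopic (f : cmap (sval X) (sval Y)).
Proof. exact: erefl. Qed.

Lemma Phi'_kernel X Y (f : phom X Y) :
  @fmor (opCat (exactCat F)) (modF F) (Phi' K) Y X f = pzero _ _ <->
  in_ideal (null_homotopic_ideal F) f.
Proof.
by rewrite in_null_homotopic_ideal Phi'_eq0E; apply: Phi'_nat_eq0.
Qed.

Lemma Phi'_nat_full X Y
    (g : natTrans (coker (cd (K (sigma' F Y)) 0))
                  (coker (cd (K (sigma' F X)) 0))) :
  exists f : phom X Y, Phi'_nat f = g.
Proof.
have [_ _ eX] := F_n_exact X; have [bY _ _] := F_n_exact Y.
have [t et] := @iso_square_ex (funCat C) _ _ _ _ (coker_choice_iso Y)
  (coker_choice_iso X) g.
have [f ef] := coker_map_full eX bY t.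
exists f; apply: (@iso_square_uniq (funCat C) _ _ _ _ (coker_choice_iso Y)
  (coker_choice_iso X) t _ g _ et).
by rewrite -ef; exact: (coker_choice_nat f).
Qed.

Lemma Phi'_full : full (Phi' K).
Proof.
move=> Y X /= g; have [f e] := @Phi'_nat_full X Y g.
by exists f; exact: e.
Qed.

Lemma Phi'_dense : dense (Phi' K).
Proof.
move=> G; have [X [FX [[a b ab ba]]]] := svalP G.
pose X' : exactCat F := exist _ X FX; exists X'.
have [c d cd dc] := coker_choice_iso X'.
constructor.
apply: (@Iso (modF F) (Phi' K X') G
  (nat_comp b d) (nat_comp c a)).
- rewrite /= -[RHS]dc; apply: natTrans_ext => Z x /=; congr (c _ _).
  exact: (congr1 (fun t : natTrans _ _ => t Z (d Z x)) ba).
- rewrite /= -[RHS]ab; apply: natTrans_ext => Z x /=; congr (b _ _).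
  exact: (congr1 (fun t : natTrans _ _ => t Z (a Z x)) cd).
Qed.

(** A contractible n-exact sequence represents the zero class, which every additive subfunctor
    contains. *)
Lemma disks_F_exact (Z : nat -> C) :
  (forall i, (n < i)%N -> isZero (Z i)) -> F_exact F (disks Z).
Proof.
move=> Z0.
have bZ : bounded n.+1 (disks Z).
  case=> // i ni; apply: isZero_bip; apply: Z0 => //.
  exact: ltnW.
exists (contractible_n_exact bZ (disks_contractible Z)).
apply: subF_zero; exact: disks_contractible.
Qed.

Lemma Phi'_objective : objective (Phi' K).
Proof.
move=> Y X f /Phi'_kernel/null_homotopic_factor[g [h e]].
have [bX _ _] := F_n_exact X.
have FZ : F_exact F (disks (fun i => cob (sval X) i.+1)).
  by apply: disks_F_exact => i ni; apply: bX.
(* The factors swap because [Phi'] is contravariant. The disk complex is killed since its identity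
   is null-homotopic. *)
exists (exist _ _ FZ), h, g; split=> //.
rewrite /zero_object -fmor1; apply/Phi'_kernel.
exact: disks_contractible.
Qed.

End PhiProperties.

Theorem theorem3p16 (L : pzRingType) (HL : artin_algebra L)
    (n : nat) (n_ge1 : (1 <= n)%N)
    (M : modCat L -> Prop) (HM : n_cluster_tilting n M)
    (F : addSubfunctor n (ctCat HM)) (K : nker_choice F) :
  [/\ full (Phi' K), dense (Phi' K), objective (Phi' K) &
      exists Phit : functor (opCat (htpyCat F)) (modF F),
        is_duality Phit /\ compFun Phit (opFun (htpyFun F)) = Phi' K].
Proof.
split; [exact: Phi'_full|exact: Phi'_dense|exact: Phi'_objective|].
exists (quot_desc (@Phi'_kernel _ _ F K)); split; last exact: quot_descE.
by apply: quot_desc_duality; [exact: Phi'_full|exact: Phi'_dense].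
Qed.
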